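(* Let $P_{XY}$ be a distribution on $\mathcal{X}\times\mathcal{Y}$ with support $\mathcal{S}=\mathsf{supp}(P_{XY})$ and $\mathsf{supp}(P_X)=\mathcal{X}$, and let $f:\mathcal{X}\times\mathcal{Y}\to\mathcal{V}=\{0,\dots,m-1\}$. Let $\mathcal{G}=(\mathcal{X},\mathcal{E})$ be the hypergraph with $\mathcal{E}=\mathcal{E}(\mathcal{S},f)$, the set of all maximal solvable hyperedges for $(\mathcal{S},f)$. Then for the i.i.d. source $(\mathbf{X},\mathbf{Y})$ with $P_{X^nY^n}=P_{XY}^n$ and $\mathbf{f}^{\mathsf t}=\{f_n^{\mathsf t}\}$, $$R(\mathbf{X}|\mathbf{Y}|\mathbf{f}^{\mathsf t})=H_{\mathcal{G}}(X|Y).$$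
   Context: Finite alphabets $\mathcal{X}=\{0,\dots,|\mathcal{X}|-1\}$, $\mathcal{Y}=\{0,\dots,|\mathcal{Y}|-1\}$. The type of $\mathbf{s}\in\mathcal{S}^n$ is $P_{\mathbf{s}}(s)=|\{i:s_i=s\}|/n$. $f_n^{\mathsf t}(\mathbf{x},\mathbf{y})$ is the type of $(f(x_1,y_1),\dots,f(x_n,y_n))$. For a sequence $\mathbf{f}=\{f_n\}$, a code is an encoder $\varphi_n:\mathcal{X}^n\to\mathcal{M}_n$ and decoder $\psi_n:\mathcal{M}_n\times\mathcal{Y}^n\to\mathcal{Z}_n$; a rate $R$ is achievable if codes exist with $\Pr(\psi_n(\varphi_n(X^n),Y^n)\ne f_n(X^n,Y^n))\to0$ and $\limsup\frac1n\log|\mathcal{M}_n|\le R$; $R(\mathbf{X}|\mathbf{Y}|\mathbf{f})$ is the infimum of achievable rates (logs base 2). Simple loop / solvability: for $\mathcal{A}\times\mathcal{B}\subseteq\mathcal{X}\times\mathcal{Y}$, a simple loop is a set $\{(a_0,b_0),(a_0,b_1),(a_1,b_1),(a_1,b_2),\dots,(a_{k-2},b_{k-1}),(a_{k-1},b_{k-1}),(a_{k-1},b_0)\}\subseteq(\mathcal{A}\times\mathcal{B})\cap\mathcal{S}$ with the $a_i$ pairwise distinct and the $b_i$ pairwise distinct. For $v\in\mathcal{V}$ let $\mathcal{I}_+(v)=\{0\le i\le k-1: f(a_i,b_i)=v\}$ and $\mathcal{I}_-(v)=\{0\le i\le k-1: f(a_i,b_{i+1\bmod k})=v\}$. $\mathcal{A}\times\mathcal{B}$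 is solvable for $(\mathcal{S},f)$ if every simple loop in it satisfies $|\mathcal{I}_+(v)|=|\mathcal{I}_-(v)|$ for all $v\in\mathcal{V}$ (vacuous if no simple loop). A set $e\subseteq\mathcal{X}$ is a solvable hyperedge if $e\times\mathcal{Y}$ is solvable for $(\mathcal{S},f)$; $\mathcal{E}(\mathcal{S},f)$ is the set of inclusion-maximal solvable hyperedges. Conditional hypergraph entropy: for a hypergraph $\mathcal{G}=(\mathcal{X},\mathcal{E})$, $\mathcal{E}\subseteq 2^{\mathcal{X}}$, $H_{\mathcal{G}}(X|Y)=\min I(W\wedge X|Y)$, where the minimum is over random variables $W$ taking values in $\mathcal{E}$ such that $W - X - Y$ is a Markov chain and $\Pr(X\in W)=1$ (i.e., over channels $P_{W|X}$ with $\sum_{w\ni x}P_{W|X}(w|x)=1$ for all $x$). *)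

(* Defs.v *)
From Stdlib Require Export Reals Lra List Arith.
Export ListNotations.
Open Scope R_scope.

Definition log2 (x : R) : R := ln x / ln 2.

Definition lsum {A : Type} (l : list A) (F : A -> R) : R :=
  fold_right Rplus 0 (map F l).

Fixpoint tuples (k n : nat) : list (list nat) :=
  match n with
  | O => [ [] ]
  | S n' => flat_map (fun a => map (cons a) (tuples k n')) (seq 0 k)
  end.

(* all subsets of {0,...,k-1}, as characteristic bit-lists of length k *)
Fixpoint bools (k : nat) : list (list bool) :=
  match k with
  | O => [ [] ]
  | S k' => flat_map (fun b => map (cons b) (bools k')) [false; true]
  end.

Definition mem (x : nat) (w : list bool) : Prop := nth x w false = true.

Section Solv.
Variables (ny m : nat) (P : nat -> nat -> R) (f : nat -> nat -> nat).

Definition inS (x y : nat) : Prop := 0 < P x y.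

Definition simple_loop (w : list bool) (a b : list nat) : Prop :=
  let k := length a in
  length b = k /\ NoDup a /\ NoDup b /\
  forall i, (i < k)%nat ->
    mem (nth i a 0%nat) w /\ (nth i b 0%nat < ny)%nat /\
    inS (nth i a 0%nat) (nth i b 0%nat) /\
    inS (nth i a 0%nat) (nth ((i + 1) mod k) b 0%nat).

Definition loop_balanced (a b : list nat) : Prop :=
  let k := length a in
  forall v, (v < m)%nat ->
    length (filter (fun i => Nat.eqb (f (nth i a 0%nat) (nth i b 0%nat)) v) (seq 0 k)) =
    length (filter (fun i => Nat.eqb (f (nth i a 0%nat) (nth ((i + 1) mod k) b 0%nat)) v)
                   (seq 0 k)).

Definition solvable (w : list bool) : Prop :=
  forall a b, simple_loop w a b -> loop_balanced a b.
End Solv.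

Definition max_solvable (nx ny m : nat) P f (w : list bool) : Prop :=
  length w = nx /\ solvable ny m P f w /\
  forall w', length w' = nx -> (forall x, mem x w -> mem x w') ->
    solvable ny m P f w' -> forall x, mem x w' -> mem x w.

(* Q w x = P_{W|X}(w|x); W ranges over E(S,f) *)
Definition feasible_channel (nx ny m : nat) P f (Q : list bool -> nat -> R) : Prop :=
  (forall w x, 0 <= Q w x) /\
  (forall w x, ~ max_solvable nx ny m P f w -> Q w x = 0) /\
  (forall x, (x < nx)%nat -> lsum (bools nx) (fun w => Q w x) = 1) /\
  (forall x, (x < nx)%nat ->
     lsum (filter (fun w => nth x w false) (bools nx)) (fun w => Q w x) = 1).

(* I(W /\ X | Y) for the joint law P_{WXY}(w,x,y) = P_XY(x,y) Q(w|x) *)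
Definition cond_mutual_info (nx ny : nat) (P : nat -> nat -> R)
    (Q : list bool -> nat -> R) : R :=
  let Pwxy w x y := P x y * Q w x in
  let Py y := lsum (seq 0 nx) (fun x => P x y) in
  let Pwy w y := lsum (seq 0 nx) (fun x => Pwxy w x y) in
  lsum (bools nx) (fun w => lsum (seq 0 nx) (fun x => lsum (seq 0 ny) (fun y =>
    if Rlt_dec 0 (Pwxy w x y)
    then Pwxy w x y * log2 (Pwxy w x y * Py y / (Pwy w y * P x y))
    else 0))).

Definition is_cond_hyp_entropy nx ny m P f (h : R) : Prop :=
  (exists Q, feasible_channel nx ny m P f Q /\ cond_mutual_info nx ny P Q = h) /\
  (forall Q, feasible_channel nx ny m P f Q -> h <= cond_mutual_info nx ny P Q).

Definition Pn (P : nat -> nat -> R) (xs ys : list nat) : R :=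
  fold_right Rmult 1 (map (fun p => P (fst p) (snd p)) (combine xs ys)).

Definition ftype (m : nat) (f : nat -> nat -> nat) (n : nat) (xs ys : list nat)
  : list R :=
  map (fun v => INR (count_occ Nat.eq_dec
                       (map (fun p => f (fst p) (snd p)) (combine xs ys)) v) / INR n)
      (seq 0 m).

Definition list_R_eq_dec : forall l1 l2 : list R, {l1 = l2} + {l1 <> l2} :=
  list_eq_dec Req_EM_T.

Definition err_prob nx ny m P f (enc : nat -> list nat -> nat)
    (dec : nat -> nat -> list nat -> list R) (n : nat) : R :=
  lsum (tuples nx n) (fun xs => lsum (tuples ny n) (fun ys =>
    Pn P xs ys *
    (if list_R_eq_dec (dec n (enc n xs) ys) (ftype m f n xs ys) then 0 else 1))).

Definition achievable nx ny m P f (r : R) : Prop :=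
  exists (M : nat -> nat) (enc : nat -> list nat -> nat)
         (dec : nat -> nat -> list nat -> list R),
    (forall n xs, In xs (tuples nx n) -> (enc n xs < M n)%nat) /\
    Un_cv (err_prob nx ny m P f enc dec) 0 /\
    (forall eps, 0 < eps -> exists N, forall n, (N <= n)%nat ->
       log2 (INR (M n)) / INR n <= r + eps).

Definition is_inf (E : R -> Prop) (l : R) : Prop :=
  (forall r, E r -> l <= r) /\ (forall b, (forall r, E r -> b <= r) -> b <= l).

(* Main.v *)
Require Import Defs.
From Stdlib Require Import Reals List.
From mathcomp Require all_boot all_order all_algebra.
From mathcomp Require all_classical all_reals topology normedtype sequences exp derive.
From mathcomp Require ring lra Rstruct Rstruct_topology.
Open Scope R_scope.

(** Converse.  Fix a code, a position [i], a codeword [m] and the side information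
    off [i].  If the letters [x] and [b] at position [i] are varied, the decoded
    types differ exactly by the values [f (x, b)], so around a loop of possible
    letters the differences cancel: these letters form a solvable set, contained
    in a maximal solvable edge [W_i] read off from [m] and the side information.
    By Jensen's inequality applied to the product of the single-letter posteriors
    of [x_i] given [W_i] and [y_i], [ln |M|] is at least the sum of the
    [I(W_i ; X_i | Y_i)], up to the vanishing cost of decoding errors.

    Achievability.  On a solvable edge [w] every indicator [f (x, y) = v] is a sum
    [alpha x + beta y] over the support.  Hence a decoder knowing [w^n] and [y^n]
    only needs the joint type of [(w^n, x^n)], which costs [O(log n)] bits.  A
    random hash puts each word [w^n] in one of about [e^(n H(W|X))] codebooks and,
    within it, in one of [e^(n (H(W|Y) - H(W|X)))] bins.  By the second moment
    method almost every [x^n] finds a good [w^n] in a fixed codebook, and the bin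
    lets the decoder recover it: the rate is [H(W|Y) - H(W|X) = I(W ; X | Y)]. *)

(* The module keeps mathcomp's reading of [<] and [<=] on [nat] out of the theorem. *)
Module TypeFunctionCoding.
Import mathcomp.boot.all_boot all_order all_algebra Rstruct Rstruct_topology.
Import all_classical all_reals topology normedtype sequences exp derive.
Import ring lra.
Set Implicit Arguments.
Unset Strict Implicit.
Unset Printing Implicit Defensive.
Import numFieldNormedType.Exports.
Import Order.TTheory GRing.Theory Num.Theory.
Local Open Scope ring_scope.
Local Notation ind b := ((b%R : bool)%:R) (only parsing).

(** The converse needs genuinely feasible channels: [W_i - X_i - Y_i] Markov and [X_i] in [W_i] with
    probability 1, although the decoder may err. A letter is therefore tested against every possible
    value of [y_i], so that [W_i] ignores the actual [y_i]; where the test fails, a cover of the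
    single letter [x_i] is used instead. A test fails only if some substitute for [y_i] causes an
    error, and as positive letter pairs have mass bounded below, this costs a constant factor in the
    error probability.

    In the direct part the decoder need not recover [x^n]: it evaluates the function at any word
    compatible with [w^n], [y^n] and the joint type. Two constraints fix the sizes. The number of
    codebooks stays exponentially below [e^(n H(W|X))], so that a typical [x^n] still sees many
    suitable words in the fixed codebook; codebooks times bins exponentially exceed [e^(n H(W|Y))],
    the number of words plausible given [y^n], so that collisions are rare.

    The statement asks for a minimum over channels, hence a compactness argument. Logarithms are
    natural until the last comparison, which divides by [ln 2]. *)

Lemma prodr_gt0_inv (R : realType) (I : finType) (F : I -> R) :
  (forall i, 0 <= F i) -> 0 < \prod_i F i -> forall i, 0 < F i.
Proof.
move=> F0 Fp i; rewrite lt_neqAle F0 andbT eq_sym; apply/negP => /eqP E.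
by move: Fp; rewrite (bigD1 i) //= E mul0r ltxx.
Qed.

Lemma mulr_gt0_inv (R : realType) (a b : R) :
  0 <= a -> 0 <= b -> 0 < a * b -> 0 < a /\ 0 < b.
Proof. by rewrite !lt0r mulf_eq0 negb_or => -> -> /andP[/andP[-> ->] _]. Qed.

Lemma ler_ind (R : realType) (a b : bool) : (a -> b) -> a%:R <= b%:R :> R.
Proof. by rewrite ler_nat; case: a b => [] [] // /(_ isT). Qed.

Lemma ln_prod (R : realType) (I : finType) (F : I -> R) :
  (forall i, 0 < F i) -> ln (\prod_i F i) = \sum_i ln (F i).
Proof.
move=> F0; elim: (index_enum I) => [|i l IH]; first by rewrite !big_nil ln1.
by rewrite !big_cons lnM ?IH // posrE // prodr_gt0.
Qed.

(** Crude, but it brings the exponentially small terms of the coding error to the form constant over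
    [n] that Chebyshev gives for the others. *)
Lemma expRN_le_inv (R : realType) (t : R) : 0 < t -> expR (- t) <= t^-1.
Proof.
move=> t0; rewrite expRN lef_pV2 ?posrE ?expR_gt0 //.
by have := expR_ge1Dx t; lra.
Qed.

(** * Product measures *)

Section ProductMeasure.
Variables (R : realType) (I T : finType).
Implicit Types (p : T -> R) (z : {ffun I -> T}).

Definition upd z i c : {ffun I -> T} := [ffun j => if j == i then c else z j].

Lemma upd_at z i c : upd z i c i = c.
Proof. by rewrite ffunE eqxx. Qed.

Lemma upd_ne z i c j : j != i -> upd z i c j = z j.
Proof. by rewrite ffunE => /negbTE ->. Qed.

Lemma upd_upd z i c d : upd (upd z i c) i d = upd z i d.
Proof. by apply/ffunP => j; rewrite !ffunE; case: eqP. Qed.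

Lemma upd_id z i : upd z i (z i) = z.
Proof. by apply/ffunP => j; rewrite ffunE; case: eqP => // ->. Qed.

Definition prodm p z : R := \prod_i p (z i).

Lemma prodm_ge0 p z : (forall c, 0 <= p c) -> 0 <= prodm p z.
Proof. by move=> p0; apply: prodr_ge0 => i _; exact: p0. Qed.

Lemma sum_prodm p : \sum_c p c = 1 -> \sum_z prodm p z = 1.
Proof.
move=> p1; rewrite /prodm -(bigA_distr_bigA (fun _ c => p c)).
by rewrite big1 // => i _; exact: p1.
Qed.

(** Cross-multiplied because [p (z i)] may be 0. *)
Lemma prodm_upd p z i c : prodm p (upd z i c) * p (z i) = prodm p z * p c.
Proof.
rewrite /prodm (bigD1 i) //= [in RHS](bigD1 i) //= upd_at.
rewrite (eq_bigr (fun j => p (z j))); last by move=> j ji; rewrite upd_ne.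
by ring.
Qed.

(** Exchanging the letter [z i] with an independent fresh letter [c] is an involution that preserves
    the joint law. This replaces conditioning on all positions but [i]. *)
Lemma resample p i (F : {ffun I -> T} -> R) : \sum_c p c = 1 ->
  \sum_z prodm p z * F z = \sum_z prodm p z * \sum_c p c * F (upd z i c).
Proof.
move=> p1; transitivity (\sum_(zc : {ffun I -> T} * T) prodm p zc.1 * p zc.2 * F zc.1).
  rewrite -(pair_bigA _ (fun z c => prodm p z * p c * F z)) /=.
  apply: eq_bigr => z _.
  by rewrite -mulr_suml -mulr_sumr p1 mulr1.
rewrite (reindex (fun zc : {ffun I -> T} * T => (upd zc.1 i zc.2, zc.1 i))) /=; last first.
  exists (fun zc => (upd zc.1 i zc.2, zc.1 i)) => -[z c] _ /=.
    by rewrite upd_upd upd_id upd_at.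
  by rewrite upd_upd upd_id upd_at.
rewrite -(pair_bigA _ (fun z c => prodm p (upd z i c) * p (z i) * F (upd z i c))) /=.
apply: eq_bigr => z _; rewrite mulr_sumr; apply: eq_bigr => c _.
by rewrite prodm_upd mulrA.
Qed.

Lemma expect_coord p i (g : T -> R) : \sum_c p c = 1 ->
  \sum_z prodm p z * g (z i) = \sum_c p c * g c.
Proof.
move=> p1; rewrite (resample i (fun z => g (z i))) //.
under eq_bigr => z _ do under eq_bigr => c _ do rewrite upd_at.
by rewrite -mulr_suml sum_prodm // mul1r.
Qed.

Lemma expect_coord2 p i j (g h : T -> R) : \sum_c p c = 1 -> i != j ->
  \sum_z prodm p z * (g (z i) * h (z j)) =
  (\sum_c p c * g c) * (\sum_c p c * h c).
Proof.
move=> p1 ij; rewrite (resample i (fun z => g (z i) * h (z j))) //.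
rewrite -(expect_coord j h p1) mulr_sumr; apply: eq_bigr => z _.
rewrite mulrCA mulr_suml; congr (_ * _); apply: eq_bigr => c _.
by rewrite upd_at upd_ne 1?eq_sym // mulrA.
Qed.

(** Cross terms vanish by independence and centring. The summand may vary with the position: for a
    random codebook the positions are words with different weights. *)
Lemma variance_sum p (g : I -> T -> R) : \sum_c p c = 1 ->
  (forall i, \sum_c p c * g i c = 0) ->
  \sum_z prodm p z * (\sum_i g i (z i)) ^+ 2 = \sum_i \sum_c p c * g i c ^+ 2.
Proof.
move=> p1 g0.
under eq_bigr => z _ do rewrite expr2 big_distrlr /= mulr_sumr.
rewrite exchange_big /=; apply: eq_bigr => i _.
under eq_bigr => z _ do rewrite mulr_sumr.
rewrite exchange_big /= (bigD1 i) //= -[RHS]addr0; congr (_ + _).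
  by rewrite (expect_coord i (fun c => g i c * g i c)) //; apply: eq_bigr.
apply: big1 => j ji.
by rewrite (expect_coord2 (g i) (g j)) 1?eq_sym // g0 mul0r.
Qed.

Lemma chebyshev_upper p (g : T -> R) (mu eps : R) : (forall c, 0 <= p c) ->
  \sum_c p c = 1 -> \sum_c p c * g c = mu -> 0 < eps -> (0 < #|I|)%N ->
  \sum_z prodm p z * ind (#|I|%:R * (mu + eps) <= \sum_i g (z i)) <=
  (\sum_c p c * (g c - mu) ^+ 2) / eps ^+ 2 / #|I|%:R.
Proof.
move=> p0 p1 gmu eps0 I0.
have n0 : 0 < (#|I|%:R : R) by rewrite ltr0n.
set V := (X in _ <= X / _ / _).
have <- : (\sum_z prodm p z * (\sum_i (g (z i) - mu)) ^+ 2) / (#|I|%:R * eps) ^+ 2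
     = V / eps ^+ 2 / #|I|%:R.
  rewrite (variance_sum (g := fun _ c => g c - mu)) //.
    rewrite sumr_const -/V -(mulr_natr V).
    by field; rewrite ?(gt_eqF n0) ?(gt_eqF eps0).
  move=> _; under eq_bigr => c _ do rewrite mulrBr.
  by rewrite sumrB gmu -mulr_suml p1 mul1r subrr.
rewrite mulr_suml; apply: ler_sum => z _; rewrite -mulrA.
apply: ler_wpM2l; first exact: prodm_ge0.
case: (leP (_ * (_ + _))) => h /=; last by rewrite divr_ge0 ?sqr_ge0.
rewrite ler_pdivlMr ?mul1r ?exprn_gt0 ?mulr_gt0 //.
have sE : \sum_i (g (z i) - mu) = \sum_i g (z i) - #|I|%:R * mu.
  by rewrite sumrB sumr_const mulr_natl.
have ns : #|I|%:R * eps <= \sum_i (g (z i) - mu) by rewrite sE lerBrDl -mulrDr.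
have ne : 0 <= #|I|%:R * eps by rewrite mulr_ge0 // ltW.
by rewrite ler_pXn2r // nnegrE // (le_trans ne ns).
Qed.
End ProductMeasure.

Lemma sum_ffun_pair (R : realType) (I A B : finType) (F : {ffun I -> A} -> {ffun I -> B} -> R) :
  \sum_x \sum_y F x y =
  \sum_(z : {ffun I -> A * B}) F [ffun i => (z i).1] [ffun i => (z i).2].
Proof.
rewrite pair_bigA /= (reindex (fun z : {ffun I -> A * B} => ([ffun i => (z i).1], [ffun i =>
  (z i).2]))) //=.
exists (fun xy : {ffun I -> A} * {ffun I -> B} => [ffun i => (xy.1 i, xy.2 i)]) => [z _|[x y] _] /=.
  by apply/ffunP => i; rewrite !ffunE -surjective_pairing.
by congr (_, _); apply/ffunP => i; rewrite !ffunE.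
Qed.

(** * Converse *)

Section SingleLetter.
Variables (R : realType) (X Y W : finType) (p : X -> Y -> R) (Q : W -> X -> R).

Definition marg y : R := \sum_x p x y.
Definition joint w y : R := \sum_x p x y * Q w x.
Definition recv w y : R := joint w y / marg y.
(** [I(W ; X | Y)] in nats: since [W - X - Y] is Markov, its density is the logarithm of
    [P(w|x) / P(w|y)], and [recv] is [P(w|y)]. Terms of mass 0 vanish whatever [ln] returns
    there. *)
Definition cmi : R :=
  \sum_w \sum_x \sum_y p x y * Q w x * (ln (Q w x) - ln (recv w y)).

Hypothesis p0 : forall x y, 0 <= p x y.
Hypothesis Q0 : forall w x, 0 <= Q w x.

Lemma marg_ge x y : p x y <= marg y.
Proof. by rewrite /marg (bigD1 x) //= lerDl sumr_ge0. Qed.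

Lemma marg_ge0 y : 0 <= marg y.
Proof. exact: sumr_ge0. Qed.

Lemma joint_ge x w y : p x y * Q w x <= joint w y.
Proof. by rewrite /joint (bigD1 x) //= lerDl sumr_ge0 // => *; rewrite mulr_ge0. Qed.

Lemma joint_ge0 w y : 0 <= joint w y.
Proof. by apply: sumr_ge0 => *; rewrite mulr_ge0. Qed.

Lemma recv_ge0 w y : 0 <= recv w y.
Proof. by rewrite divr_ge0 ?joint_ge0 ?marg_ge0. Qed.

Lemma recv_gt0 w x y : 0 < p x y -> 0 < Q w x -> 0 < recv w y.
Proof.
move=> px qx; rewrite divr_gt0 //; first exact: lt_le_trans (mulr_gt0 px qx) (joint_ge _ _ _).
exact: lt_le_trans px (marg_ge _ _).
Qed.
End SingleLetter.

(** * A lower bound on the positive masses *)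

Section InverseMass.
Variables (R : realType) (X Y : finType) (p : X -> Y -> R).
Hypothesis p0 : forall x y, 0 <= p x y.
Hypothesis p1 : \sum_x \sum_y p x y = 1.

(** An upper bound for the inverse of the least positive mass; null cells contribute [0^-1 = 0], so
    no minimum over the support is needed. *)
Definition invmass : R := \sum_x \sum_y (p x y)^-1.

Lemma invmass_ge x y : (p x y)^-1 <= invmass.
Proof.
rewrite /invmass (bigD1 x) //= (bigD1 y) //= -addrA lerDl addr_ge0 ?sumr_ge0 //.
  by move=> *; rewrite invr_ge0.
by move=> *; rewrite sumr_ge0 // => *; rewrite invr_ge0.
Qed.

Lemma pmf_le1 x y : p x y <= 1.
Proof.
rewrite -p1 (bigD1 x) //= (bigD1 y) //= -addrA lerDl addr_ge0 ?sumr_ge0 //.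
by move=> *; rewrite sumr_ge0.
Qed.

Lemma pmf_pos_ex : exists x y, 0 < p x y.
Proof.
apply: contrapT => h; have : \sum_x \sum_y p x y = 0.
  apply: big1 => x _; apply: big1 => y _; apply/eqP; rewrite eq_le p0 andbT leNgt.
  by apply/negP => xy; apply: h; exists x, y.
by rewrite p1 => /eqP; rewrite oner_eq0.
Qed.

Lemma invmass_ge1 : 1 <= invmass.
Proof.
have [x [y xy]] := pmf_pos_ex.
by rewrite (le_trans _ (invmass_ge x y)) // invf_ge1 // pmf_le1.
Qed.

Lemma invmass_mul x y : 0 < p x y -> 1 <= invmass * p x y.
Proof. by move=> xy; rewrite -ler_pdivrMr // mul1r invmass_ge. Qed.
End InverseMass.

(** * From a code to single-letter channels *)

Section Converse.
Variables (R : realType) (I X Y M : finType) (Z : eqType) (p : X -> Y -> R).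
Hypothesis p0 : forall x y, 0 <= p x y.
Hypothesis p1 : \sum_x \sum_y p x y = 1.
Variables (phi : {ffun I -> X} -> M) (psi : M -> {ffun I -> Y} -> Z).
Variable fn : {ffun I -> X} -> {ffun I -> Y} -> Z.

Local Notation Pn x y := (\prod_i p (x i) (y i)).
Local Notation p2 := (fun c : X * Y => p c.1 c.2).
Local Notation xs z := [ffun i : I => (z i).1].
Local Notation ys z := [ffun i : I => (z i).2].
Implicit Types z : {ffun I -> X * Y}.

Definition error_mass : R :=
  \sum_(x : {ffun I -> X}) \sum_(y : {ffun I -> Y})
    Pn x y * ind (psi (phi x) y != fn x y).

(* The letters compatible, at position [i], with the codeword [m] and the side
   information [y] off [i], as far as the decoder makes no mistake when letter [i]
   of [y] varies. *)
Definition confusable i (m : M) (y : {ffun I -> Y}) : {set X} :=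
  [set a | [exists x : {ffun I -> X}, [&& phi x == m, x i == a &
    [forall b, (0 < p a b) ==> (psi m (upd y i b) == fn x (upd y i b))]]]].

(** Source of the Markov property: the edge built from this set cannot depend on [y i]. *)
Lemma confusable_upd i m y b : confusable i m (upd y i b) = confusable i m y.
Proof.
apply/setP => a; rewrite !inE; apply: eq_existsb => x.
by congr [&& _, _ & _]; apply: eq_forallb => b'; rewrite upd_upd.
Qed.

Let p20 c : 0 <= p2 c. Proof. exact: p0. Qed.
Let p21 : \sum_c p2 c = 1.
Proof. by rewrite -p1 pair_bigA. Qed.

Lemma error_massE : error_mass = \sum_z prodm p2 z * ind (psi (phi (xs z)) (ys z) != fn (xs z)
  (ys z)).
Proof.
rewrite /error_mass sum_ffun_pair; apply: eq_bigr => z _; congr (_ * _).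
by apply: eq_bigr => i _; rewrite !ffunE.
Qed.

Let pairE (F : X * Y -> R) : \sum_c F c = \sum_a \sum_b F (a, b).
Proof. by rewrite pair_bigA; apply: eq_bigr => -[]. Qed.

Let xs_upd z i c : xs (upd z i c) = upd (xs z) i c.1.
Proof. by apply/ffunP => j; rewrite !ffunE; case: eqP. Qed.

Let ys_upd z i c : ys (upd z i c) = upd (ys z) i c.2.
Proof. by apply/ffunP => j; rewrite !ffunE; case: eqP. Qed.

(** If the letter at [i] fails the test on the actual word, some [b] of positive mass put at [i]
    makes the decoder err. After resampling position [i], that substitution is an ordinary draw
    whose mass is at least the inverse of [invmass p]. *)
Lemma not_confusable_mass i :
  \sum_z prodm p2 z * ind (~~ ((z i).1 \in confusable i (phi (xs z)) (ys z)))
  <= invmass p * error_mass.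
Proof.
pose er z := ind (psi (phi (xs z)) (ys z) != fn (xs z) (ys z)) : R.
apply: (@le_trans _ _ (\sum_z prodm p2 z * \sum_b ind (0 < p (z i).1 b) * er (upd z i ((z i).1,
  b)))).
  apply: ler_sum => z _; apply: ler_wpM2l; first exact: prodm_ge0.
  have t0 : 0 <= \sum_b ind (0 < p (z i).1 b) * er (upd z i ((z i).1, b)).
    by apply: sumr_ge0 => b _; rewrite mulr_ge0.
  have [//|/negP h] := boolP (_ \in _).
  suff [b b1 b2] : exists2 b, 0 < p (z i).1 b & psi (phi (xs z)) (upd (ys z) i b) != fn (xs z)
    (upd (ys z) i b).
    rewrite (bigD1 b) //= b1 mul1r /er xs_upd ys_upd /=.
    have -> : upd (xs z) i (z i).1 = xs z by rewrite -[RHS](upd_id _ i) ffunE.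
    by rewrite b2 lerDl; apply: sumr_ge0 => *; rewrite mulr_ge0.
  apply: contrapT => hn; apply: h; rewrite inE; apply/existsP; exists (xs z).
  rewrite eqxx ffunE eqxx /=; apply/forallP => b; apply/implyP => pb.
  by apply/negPn/negP => hb; apply: hn; exists b.
rewrite (resample i) // error_massE (resample i (fun z => er z)) // mulr_sumr.
apply: ler_sum => z _; rewrite mulrCA; apply: ler_wpM2l; first exact: prodm_ge0.
rewrite !pairE /= mulr_sumr.
apply: ler_sum => a _.
under eq_bigr => b _ do rewrite upd_at /=.
under eq_bigr => b _ do under eq_bigr => b0 _ do rewrite upd_upd.
rewrite -mulr_suml mulr_sumr mulr_sumr; apply: ler_sum => b _.
have [pb|pb] := ltP 0 (p a b);
  last by rewrite mul0r mulr0 !mulr_ge0 // (le_trans ler01) // invmass_ge1.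
rewrite mul1r mulrA; apply: ler_wpM2r; first by rewrite /er.
apply: le_trans (invmass_mul p0 pb).
rewrite -p1 (bigD1 a) //= lerDl; apply: sumr_ge0 => *; exact: sumr_ge0.
Qed.

Variables (edge sol : {set X} -> Prop) (cover : {set X} -> {set X}) (h : R).
Hypothesis h_min : forall Q : {set X} -> X -> R,
  (forall w x, 0 <= Q w x) -> (forall x, \sum_w Q w x = 1) ->
  (forall w x, ~ edge w -> Q w x = 0) -> (forall (w : {set X}) x, x \notin w -> Q w x = 0) ->
  h <= cmi p Q.
Hypothesis coverP : forall A, sol A -> edge (cover A) /\ A \subset cover A.
Hypothesis sol1 : forall x, sol [set x].
Hypothesis sol_confusable : forall i m y, sol (confusable i m y).

(* Letting the edge depend on [x i] in the (unlikely) case of a decoding mistake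
   makes [aux_channel i] exactly feasible. *)
Definition aux_edge i (x : {ffun I -> X}) y : {set X} :=
  let A := confusable i (phi x) y in cover (if x i \in A then A else [set x i]).

Lemma aux_edgeP i x y : edge (aux_edge i x y) /\ x i \in aux_edge i x y.
Proof.
rewrite /aux_edge; case: ifP => xi.
  by have [e /fintype.subsetP s] := coverP (sol_confusable i (phi x) y); split => //; exact: s.
by have [e /fintype.subsetP s] := coverP (sol1 (x i)); split => //; apply: s; rewrite inE.
Qed.

Lemma aux_edge_upd i x y b : aux_edge i x (upd y i b) = aux_edge i x y.
Proof. by rewrite /aux_edge confusable_upd. Qed.

(** The law of the auxiliary edge given [x i = a]. Positions being independent, planting [a] in a
    random word replaces conditioning. *)
Definition aux_channel i (w : {set X}) a : R :=
  \sum_z prodm p2 z * ind (aux_edge i (upd (xs z) i a) (ys z) == w).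

Lemma aux_channel_ge0 i w a : 0 <= aux_channel i w a.
Proof. by apply: sumr_ge0 => z _; rewrite mulr_ge0 // prodm_ge0. Qed.

Lemma sum_ind_eq (T : finType) (t : T) (G : T -> R) : \sum_w ind (t == w) * G w = G t.
Proof.
rewrite (bigD1 t) //= eqxx mul1r big1 ?addr0 // => w.
by rewrite eq_sym => /negbTE ->; rewrite mul0r.
Qed.

Lemma aux_channel_feasible i : h <= cmi p (aux_channel i).
Proof.
apply: h_min.
- exact: aux_channel_ge0.
- move=> x; rewrite exchange_big /=; transitivity (\sum_(z : {ffun I -> X * Y}) prodm p2 z);
  last exact: sum_prodm.
  apply: eq_bigr => z _.
  rewrite -mulr_sumr -[RHS]mulr1; congr (_ * _).
  by rewrite -[RHS](sum_ind_eq (aux_edge i (upd (xs z) i x) (ys z)) (fun=> 1));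
    apply: eq_bigr => w _; rewrite mulr1.
- move=> w x we; apply: big1 => z _; case: eqP => [E|_]; last by rewrite mulr0.
  by case: we; rewrite -E; case: (aux_edgeP i (upd (xs z) i x) (ys z)).
- move=> w x xw; apply: big1 => z _; case: eqP => [E|_]; last by rewrite mulr0.
  have [_] := aux_edgeP i (upd (xs z) i x) (ys z).
  by rewrite E upd_at (negbTE xw).
Qed.

Definition density i z : R :=
  let w := aux_edge i (xs z) (ys z) in
  ln (aux_channel i w (z i).1) - ln (recv p (aux_channel i) w (z i).2).

(** Once position [i] is resampled, its letters are independent of the rest and the edge ignores the
    new [y i], so averaging over the rest yields [aux_channel i]. *)
Lemma density_mean i : \sum_z prodm p2 z * density i z = cmi p (aux_channel i).
Proof.
set Q := aux_channel i; pose G w (c : X * Y) := ln (Q w c.1) - ln (recv p Q w c.2).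
rewrite (resample i) //.
transitivity (\sum_z prodm p2 z * \sum_c p2 c * \sum_w ind (aux_edge i (upd (xs z) i c.1) (ys z)
  == w) * G w c).
  apply: eq_bigr => z _; congr (_ * _); apply: eq_bigr => c _; congr (_ * _).
  by rewrite sum_ind_eq /density xs_upd ys_upd aux_edge_upd !upd_at.
rewrite /cmi.
under eq_bigr => z _ do rewrite mulr_sumr.
rewrite exchange_big /=.
transitivity (\sum_c \sum_w p c.1 c.2 * Q w c.1 * G w c).
  apply: eq_bigr => c _.
  under eq_bigr => z _ do (rewrite mulrCA mulr_sumr; under eq_bigr => w _ do rewrite mulrA).
  rewrite -mulr_sumr exchange_big mulr_sumr /=; apply: eq_bigr => w _.
  by rewrite -mulr_suml mulrA.
rewrite exchange_big /=; apply: eq_bigr => w _.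
by rewrite pair_bigA.
Qed.

(** * Posteriors and the change of measure *)

Section Jensen.
Variable d : R.
Hypothesis d01 : 0 < d < 1.

(* The law of [x i] given the auxiliary edge and [y i], mixed with the uniform law
   so that its logarithm stays bounded on decoding mistakes. *)
Definition posterior i m y a : R :=
  let w := cover (confusable i m y) in
  (1 - d) * (p a (y i) * aux_channel i w a / joint p (aux_channel i) w (y i)) + d / #|X|%:R.

(** Likelihood ratio of the product of posteriors to the true law of [x] given [y]. *)
Definition gain z : R :=
  \prod_i (posterior i (phi (xs z)) (ys z) (z i).1 * marg p (z i).2 / p2 (z i)).

Let X_gt0 : 0 < (#|X|%:R : R).
Proof. by have [x _] := pmf_pos_ex p0 p1; rewrite ltr0n; apply/card_gt0P; exists x. Qed.

Let dX_gt0 : 0 < d / #|X|%:R.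
Proof. by case/andP: d01 => d0 _; rewrite divr_gt0. Qed.

Lemma posterior_ge i m y a : d / #|X|%:R <= posterior i m y a.
Proof.
rewrite /posterior lerDr mulr_ge0 //; first by case/andP: d01 => _ /ltW; rewrite subr_ge0.
by rewrite divr_ge0 ?mulr_ge0 ?aux_channel_ge0 // joint_ge0 // => *; exact: aux_channel_ge0.
Qed.

Lemma posterior_sum i m y : \sum_a posterior i m y a <= 1.
Proof.
case/andP: d01 => d0 d1.
rewrite /posterior big_split /= sumr_const -mulr_sumr -mulr_suml.
rewrite -(mulr_natr (d / _)) divfK ?(gt_eqF X_gt0) //.
set J := joint _ _ _ _; rewrite -/(joint p (aux_channel i) _ _) -/J.
have : J / J <= 1 by have [->|J0] := eqVneq J 0; rewrite ?mul0r ?ler01 // divff.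
by move=> h1; have : (1 - d) * (J / J) <= (1 - d) * 1; [apply: ler_wpM2l => //; lra | lra].
Qed.

(* For fixed [m] and [y] the posteriors multiply to a subprobability in [x]; this
   single bound replaces the usual chain of entropy inequalities. *)
Lemma gain_mean : \sum_z prodm p2 z * gain z <= #|M|%:R.
Proof.
apply: (@le_trans _ _ (\sum_(z : {ffun I ->
  X * Y}) \prod_i (posterior i (phi (xs z)) (ys z) (xs z i) * marg p (ys z i)))).
  apply: ler_sum => z _; rewrite /gain /prodm -big_split /=.
  have t0 i : 0 <= posterior i (phi (xs z)) (ys z) (xs z i) * marg p (ys z i).
    by rewrite mulr_ge0 ?marg_ge0 // (le_trans (ltW dX_gt0)) // posterior_ge.
  apply: ler_prod => i _; rewrite -[xs z i]ffunE -[ys z i]ffunE !ffunE.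
  have := t0 i; rewrite !ffunE => t0i.
  have [->|pz] := eqVneq (p (z i).1 (z i).2) 0; first by rewrite mul0r lexx.
  by rewrite [p _ _ * _]mulrC divfK // lexx andbT.
rewrite -(sum_ffun_pair (fun x y =>
  \prod_i (posterior i (phi x) y (x i) * marg p (y i)))) exchange_big /=.
have mE : \sum_(y : {ffun I -> Y}) \prod_i marg p (y i) = 1.
  by apply: (sum_prodm I (p := marg p)); rewrite exchange_big.
rewrite (_ : #|M|%:R = \sum_(y : {ffun I -> Y}) (\prod_i marg p (y i)) * #|M|%:R); last first.
  by rewrite -mulr_suml mE mul1r.
apply: ler_sum => y _.
under eq_bigr => x _ do rewrite big_split /= mulrC.
rewrite -mulr_sumr; apply: ler_wpM2l; first by apply: prodr_ge0 => *; exact: marg_ge0.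
(* Summing over all messages instead of keeping [phi x] frees the posteriors from [x], so the sum
   over [x] factors; this is where [#|M|] enters. *)
apply: (@le_trans _ _ (\sum_(x : {ffun I -> X}) \sum_m \prod_i posterior i m y (x i))).
  apply: ler_sum => x _; rewrite [leRHS](bigD1 (phi x)) //= lerDl.
  by apply: sumr_ge0 => m _; apply: prodr_ge0 => i _; rewrite (le_trans (ltW dX_gt0)) ?posterior_ge.
rewrite exchange_big /= -sumr_const; apply: ler_sum => m _.
rewrite -(bigA_distr_bigA (fun i a => posterior i m y a)).
apply: prodr_ile1 => i _; rewrite posterior_sum andbT.
by apply: sumr_ge0 => a _; rewrite (le_trans (ltW dX_gt0)) ?posterior_ge.
Qed.

(** Worst loss at a position failing the test: the density is at most [ln (invmass p)], while the
    logarithm in [gain] is at least [ln (d / #|X|)]. *)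
Definition penalty : R := ln (invmass p) - ln (d / #|X|%:R).

Lemma penalty_ge0 : 0 <= penalty.
Proof.
have D1 := invmass_ge1 p0 p1.
case/andP: d01 => d0 d1.
rewrite /penalty subr_ge0 (@le_trans _ _ 0) ?ln_ge0 //.
rewrite ln_le0 // ler_pdivrMr // mul1r (le_trans (ltW d1)) // ler1n -(ltr0n R).
exact: X_gt0.
Qed.

(** If the letter passes the test, the edge used by [posterior] is the auxiliary edge, and Bayes'
    rule turns the factor into at least [1 - d] times [P(w|x) / P(w|y)]. Otherwise the two crude
    bounds behind [penalty] apply. *)
Lemma gain_term i z : 0 < prodm p2 z ->
  density i z + ln (1 - d) - penalty * ind (~~ ((z i).1 \in confusable i (phi (xs z)) (ys z)))
  <= ln (posterior i (phi (xs z)) (ys z) (z i).1 * marg p (z i).2 / p2 (z i)).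
Proof.
move=> Pz; case/andP: d01 => d0 d1.
have pz : 0 < p (z i).1 (z i).2 by exact: (prodr_gt0_inv _ Pz).
set Q := aux_channel i; set w := aux_edge i (xs z) (ys z).
have Qz : 0 < Q w (z i).1.
  rewrite /Q /aux_channel (bigD1 z) //=.
  have -> : upd (xs z) i (z i).1 = xs z by rewrite -[RHS](upd_id _ i) ffunE.
  by rewrite eqxx mulr1 ltr_wpDr // sumr_ge0 // => *; rewrite mulr_ge0 // prodm_ge0.
have mz : 0 < marg p (z i).2 by apply: lt_le_trans pz _; exact: marg_ge.
have Jz : 0 < joint p Q w (z i).2.
  apply: (lt_le_trans (mulr_gt0 pz Qz)); apply: joint_ge => // *; exact: aux_channel_ge0.
have rz : 0 < recv p Q w (z i).2 by rewrite divr_gt0.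
rewrite /density -/Q -/w -ln_div ?posrE //.
case: (boolP (_ \in _)) => xA /=.
  have wE : cover (confusable i (phi (xs z)) (ys z)) = w.
    by rewrite /w /aux_edge ffunE xA.
  rewrite mulr0 subr0 -lnM ?posrE ?divr_gt0 //; last by rewrite subr_gt0.
  rewrite ler_ln ?posrE ?mulr_gt0 ?invr_gt0 ?subr_gt0 //; last first.
    by rewrite (lt_le_trans dX_gt0) ?posterior_ge.
  rewrite /posterior wE ffunE -/Q.
  set J := joint _ _ _ _ in Jz *; set mg := marg _ _ in mz *.
  set pp := p _ _ in pz *; set q := Q _ _ in Qz *.
  have -> : q / recv p Q w (z i).2 * (1 - d) = (1 - d) * (pp * q / J) * mg / pp.
    by rewrite /recv -/J -/mg; field; rewrite ?(gt_eqF Jz) ?(gt_eqF pz) ?(gt_eqF mz).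
  apply: ler_wpM2r; first by rewrite invr_ge0 ltW.
  by apply: ler_wpM2r; [exact: ltW | rewrite lerDl ltW].
rewrite mulr1 /penalty.
have k1 : ln (Q w (z i).1 / recv p Q w (z i).2) <= ln (invmass p).
  rewrite ler_ln ?posrE ?divr_gt0 //; last by rewrite (lt_le_trans ltr01) ?invmass_ge1.
  apply: le_trans (invmass_ge p0 (z i).1 (z i).2).
  rewrite ler_pdivrMr // mulrC ler_pdivlMr // mulrC /recv ler_pdivlMr //.
  apply: (@le_trans _ _ (p (z i).1 (z i).2 * Q w (z i).1)); last first.
    by apply: joint_ge => // *; exact: aux_channel_ge0.
  rewrite ler_piMr // ?mulr_ge0 ?(ltW Qz) //.
  rewrite -p1 exchange_big /= (bigD1 (z i).2) //= lerDl.
  by apply: sumr_ge0 => *; exact: sumr_ge0.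
have k2 : ln (1 - d) <= 0 by rewrite ln_le0 //; lra.
have k3 : ln (d / #|X|%:R) <= ln (posterior i (phi (xs z)) (ys z) (z i).1 * marg p (z i).2 / p2
  (z i)).
  have t1 : d / #|X|%:R <= posterior i (phi (xs z)) (ys z) (z i).1 * marg p (z i).2 / p2 (z i).
    rewrite -mulrA -[leLHS]mulr1; apply: ler_pM; rewrite ?ler01 ?(ltW dX_gt0) ?posterior_ge //.
    by rewrite ler_pdivlMr // mul1r; exact: marg_ge.
  by rewrite ler_ln ?posrE // (lt_le_trans dX_gt0).
by rewrite -/Q; lra.
Qed.

(** Jensen's inequality in the form [ln t <= t - 1] at [t = gain z / #|M|], averaged over words of
    positive mass; by [gain_mean] the average of [t - 1] is at most 0. *)
Lemma converse : (0 < #|I|)%N ->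
  #|I|%:R * (h + ln (1 - d) - penalty * (invmass p * error_mass)) <= ln #|M|%:R.
Proof.
move=> I0; have M0 : 0 < (#|M|%:R : R).
  have [x _] := pmf_pos_ex p0 p1.
  by rewrite ltr0n; apply/card_gt0P; exists (phi [ffun=> x]).
pose bad i z := ind (~~ ((z i).1 \in confusable i (phi (xs z)) (ys z))) : R.
have step z : prodm p2 z * \sum_i (density i z + ln (1 - d) - penalty * bad i z) <=
    prodm p2 z * (gain z / #|M|%:R - 1 + ln #|M|%:R).
  have [Pz|Pz] := ltP 0 (prodm p2 z); last first.
    have -> : prodm p2 z = 0 by apply/eqP; rewrite eq_le Pz prodm_ge0.
    by rewrite !mul0r.
  rewrite ler_pM2l //.
  have pz : forall i, 0 < p (z i).1 (z i).2 by exact: prodr_gt0_inv Pz.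
  have tz i : 0 < posterior i (phi (xs z)) (ys z) (z i).1 * marg p (z i).2 / p2 (z i).
    rewrite divr_gt0 // mulr_gt0 //; first by rewrite (lt_le_trans dX_gt0) ?posterior_ge.
    by apply: lt_le_trans (pz i) _; exact: marg_ge.
  have gE : ln (gain z) = \sum_i ln (posterior i (phi (xs z)) (ys z) (z i).1 * marg p (z i).2 /
    p2 (z i)).
    exact: ln_prod.
  have gz : 0 < gain z by rewrite /gain prodr_gt0.
  apply: (@le_trans _ _ (ln (gain z))).
    by rewrite gE; apply: ler_sum => i _; exact: gain_term.
  have -> : ln (gain z) = ln (gain z / #|M|%:R) + ln #|M|%:R.
    by rewrite ln_div ?posrE // subrK.
  rewrite lerD2r; have := @le_ln1Dx R (gain z / #|M|%:R - 1).
  by rewrite addrCA subrr addr0; apply; rewrite ltrBrDl subrr divr_gt0.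
have := @ler_sum R _ (index_enum _) xpredT _ _ (fun z _ => step z).
have -> : \sum_z prodm p2 z * (gain z / #|M|%:R - 1 + ln #|M|%:R) =
   (\sum_z prodm p2 z * gain z) / #|M|%:R - 1 + ln #|M|%:R.
  have S1 := sum_prodm I p21.
  under eq_bigr => z _ do rewrite mulrDr mulrBr mulr1 mulrA.
  by rewrite big_split /= sumrB -!mulr_suml S1 mul1r.
have -> : \sum_z prodm p2 z * (\sum_i (density i z + ln (1 - d) - penalty * bad i z)) =
   \sum_i (cmi p (aux_channel i) + ln (1 - d) - penalty * \sum_z prodm p2 z * bad i z).
  under eq_bigr => z _ do rewrite mulr_sumr.
  rewrite exchange_big /=; apply: eq_bigr => i _.
  under eq_bigr => z _ do rewrite mulrBr mulrDr mulrCA.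
  by rewrite sumrB big_split /= density_mean -mulr_suml sum_prodm // mul1r -mulr_sumr.
move=> key.
have gm : (\sum_z prodm p2 z * gain z) / #|M|%:R <= 1 by rewrite ler_pdivrMr // mul1r gain_mean.
apply: (le_trans _ (le_trans key _)); last lra.
rewrite mulr_natl -sumr_const; apply: ler_sum => i _.
have := aux_channel_feasible i.
have : penalty * (\sum_z prodm p2 z * bad i z) <= penalty * (invmass p * error_mass).
  by apply: ler_wpM2l; [exact: penalty_ge0 | exact: not_confusable_mass].
by lra.
Qed.
End Jensen.
End Converse.

(** * Random coding *)

Section Expectation.
Variables (R : realType) (T : finType) (p : T -> R).
Hypothesis p0 : forall t, 0 <= p t.
Hypothesis p1 : \sum_t p t = 1.

Definition ev (g : T -> R) : R := \sum_t p t * g t.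

Lemma ev_cst c : ev (fun=> c) = c.
Proof. by rewrite /ev -mulr_suml p1 mul1r. Qed.

Lemma evD g h : ev (fun t => g t + h t) = ev g + ev h.
Proof. by rewrite /ev -big_split /=; apply: eq_bigr => t _; rewrite mulrDr. Qed.

Lemma evZ c g : ev (fun t => c * g t) = c * ev g.
Proof. by rewrite /ev mulr_sumr; apply: eq_bigr => t _; rewrite mulrCA. Qed.

Lemma ev_sum (J : finType) (P : pred J) (g : J -> T -> R) :
  ev (fun t => \sum_(j | P j) g j t) = \sum_(j | P j) ev (g j).
Proof.
rewrite /ev; under eq_bigr => t _ do rewrite mulr_sumr.
by rewrite exchange_big.
Qed.

Lemma eq_ev g h : g =1 h -> ev g = ev h.
Proof. by move=> gh; apply: eq_bigr => t _; rewrite gh. Qed.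

Lemma ev_le g h : (forall t, g t <= h t) -> ev g <= ev h.
Proof. by move=> gh; apply: ler_sum => t _; apply: ler_wpM2l. Qed.

Lemma ev_ex g c : ev g <= c -> exists t, g t <= c.
Proof.
move=> gc; apply: contrapT => hn.
have lt_g t : c < g t by rewrite ltNge; apply/negP => ht; apply: hn; exists t.
have : ev (fun t => g t - c) <= 0.
  have -> : ev (fun t => g t - c) = ev g - c by rewrite evD ev_cst.
  by rewrite subr_le0.
apply/negP; rewrite -ltNge /ev.
have [t pt] : exists t, 0 < p t.
  apply: contrapT => hp; move: p1; rewrite big1 => [/eqP|t _]; first by rewrite eq_sym oner_eq0.
  apply/eqP; rewrite eq_le p0 andbT leNgt; apply/negP => pt; apply: hp; by exists t.
rewrite (bigD1 t) //= ltr_wpDr ?mulr_gt0 ?subr_gt0 //.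
by apply: sumr_ge0 => s _; rewrite mulr_ge0 // subr_ge0 ltW.
Qed.
End Expectation.

Section OneShot.
Variables (R : realType) (A B C : finType) (P : A -> B -> R) (q : C -> A -> R).
Hypothesis P0 : forall x y, 0 <= P x y.
Hypothesis P1 : \sum_x \sum_y P x y = 1.
Hypothesis q0 : forall w x, 0 <= q w x.
Hypothesis q1 : forall x, \sum_w q w x = 1.
Variables (T1 : C -> A -> bool) (T2 : C -> B -> bool) (K L : nat) (theta N eta : R).
Hypothesis eta0 : 0 < eta.
Hypothesis theta0 : 0 <= theta.
Hypothesis T1P : forall w x, T1 w x -> q w x <= theta.
Hypothesis T2P : forall y, \sum_w ind (T2 w y) <= N.
Variable w0 : C.

Local Notation U := ('I_K.+1 * 'I_L.+1)%type.

(* [(F w).1 == ord0] says that [w] belongs to the codebook drawn by [F], and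
   [(F w).2] is its bin. *)
Definition decodable (F : {ffun C -> U}) w x y :=
  [&& 0 < q w x, (F w).1 == ord0, T2 w y &
      [forall w', (F w' == F w) && T2 w' y ==> (w' == w)]].

Let u (_ : U) : R := (K.+1 * L.+1)%:R^-1.
Let PX x := \sum_y P x y.
(** Failure mass when [x] is encoded as [w]; the encoder will choose the minimiser [best]. *)
Let cost (F : {ffun C -> U}) x w := \sum_y P x y * ind (~~ decodable F w x y).
Let best F x : C := [arg min_(w < w0) cost F x w]%O.
(** Truncation to [T1] caps each weight by [theta], which controls the second moment. *)
Let a x w := q w x * ind (T1 w x).
(** Membership in the codebook, scaled to mean 1. *)
Let k (c : U) : R := K.+1%:R * ind (c.1 == ord0).
Let miss (F : {ffun C -> U}) x w := \sum_y P x y *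
  (ind (~~ T2 w y) + \sum_(w' | w' != w) ind (T2 w' y) * ind (F w' == F w)).

Let u0 c : 0 <= u c. Proof. by rewrite invr_ge0. Qed.

Let u1 : \sum_c u c = 1.
Proof.
by rewrite sumr_const card_prod !card_ord -[LHS]mulr_natr mulVf // pnatr_eq0 muln_eq0.
Qed.

Let sum_first : \sum_c u c * k c = 1.
Proof.
rewrite -mulr_sumr -mulr_sumr /=.
rewrite (eq_bigr (fun c : U => ind (c.1 == ord0) * 1)); last by move=> c _; rewrite mulr1.
rewrite -(pair_bigA _ (fun (i : 'I_K.+1) (_ : 'I_L.+1) => ind (i == ord0) * 1)) /=.
rewrite (bigD1 ord0) //= [X in _ + X]big1 => [|i /negbTE ->]; last first.
  by rewrite big1 // => *; rewrite mul0r.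
by rewrite mulr1 sumr_const card_ord addr0 -natrM mulVf // pnatr_eq0 muln_eq0.
Qed.

Let kk c : k c ^+ 2 = K.+1%:R * k c.
Proof. by rewrite /k; case: eqP => _; rewrite ?mulr0 ?expr0n ?mulr0 // !mulr1 expr2. Qed.

Let sum_variance : \sum_c u c * (1 - k c) ^+ 2 = K%:R.
Proof.
transitivity (\sum_c (u c + (K.+1%:R - 2) * (u c * k c))).
  by apply: eq_bigr => c _; rewrite -natr1; have := kk c; rewrite -natr1 => E;
    rewrite sqrrB expr1n E; ring.
by rewrite big_split /= -mulr_sumr sum_first u1 mulr1 -natr1; ring.
Qed.

Let ev_k w : ev (prodm u) (fun F : {ffun C -> U} => k (F w)) = 1.
Proof. by rewrite /ev (expect_coord w k) // sum_first. Qed.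

(** Splitting over the common value of the two hashes separates [w] from [w'], whose hashes are
    independent. *)
Let ev_collide w w' : w' != w ->
  ev (prodm u) (fun F : {ffun C -> U} => k (F w) * ind (F w' == F w)) = (K.+1 * L.+1)%:R^-1.
Proof.
move=> ww; pose v : R := (K.+1 * L.+1)%:R^-1.
have uE c : \sum_d u d * ind (d == c) = v.
  rewrite (bigD1 c) //= eqxx mulr1 big1 ?addr0 // => d /negbTE ->; exact: mulr0.
transitivity (ev (prodm u) (fun F : {ffun C -> U} =>
  \sum_c k c * (ind (F w == c) * ind (F w' == c)))).
  apply: eq_ev => F; rewrite (bigD1 (F w)) //= eqxx mul1r big1 ?addr0 // => c.
  by rewrite eq_sym => /negbTE ->; rewrite mul0r mulr0.
rewrite ev_sum.
transitivity (\sum_c v * (u c * k c)).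
  apply: eq_bigr => c _; rewrite evZ.
  rewrite /ev (expect_coord2 (fun d => ind (d == c)) (fun d => ind (d == c))) //;
    last by rewrite eq_sym.
  by rewrite uE /u -/v; ring.
by rewrite -mulr_sumr sum_first mulr1.
Qed.

Let PX_ge0 x : 0 <= PX x. Proof. exact: sumr_ge0. Qed.
Let a_ge0 x w : 0 <= a x w. Proof. by rewrite mulr_ge0. Qed.
Let k_ge0 c : 0 <= k c. Proof. by rewrite mulr_ge0. Qed.

Let sum_a_le1 x : \sum_w a x w <= 1.
Proof.
rewrite -(q1 x); apply: ler_sum => w _; rewrite ler_piMr //.
by case: (T1 w x).
Qed.

Let cost_ge0 F x w : 0 <= cost F x w.
Proof. by apply: sumr_ge0 => y _; rewrite mulr_ge0. Qed.

Let cost_le F x w : cost F x w <= PX x.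
Proof. by apply: ler_sum => y _; rewrite ler_piMr //; case: (decodable _ _ _ _). Qed.

Let best_le F x w : cost F x (best F x) <= cost F x w.
Proof. by rewrite /best; case: arg_minP => // w' _; apply. Qed.

(** Union bound: a codeword fails only if it is outside the list of [y] or collides with another
    member of that list. *)
Let cost_miss (F : {ffun C -> U}) x w : 0 < a x w * k (F w) -> cost F x w <= miss F x w.
Proof.
move=> ak; apply: ler_sum => y _; apply: ler_wpM2l => //.
have n0 : 0 <= \sum_(w' | w' != w) ind (T2 w' y) * ind (F w' == F w) :> R.
  by apply: sumr_ge0 => *; rewrite mulr_ge0.
have qw : 0 < q w x.
  rewrite lt_neqAle q0 andbT eq_sym; apply/eqP => E.
  by move: ak; rewrite /a E !mul0r ltxx.
have Fw : (F w).1 == ord0.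
  by case E: (_ == _) => //; move: ak; rewrite /k E !mulr0 ltxx.
rewrite /decodable qw Fw /=; case: (T2 w y) => /=; last by rewrite lerDl.
rewrite add0r; case: forallP => //= H.
have [w' /andP[w'w /andP[Ew Tw]]] : exists w', (w' != w) && ((F w' == F w) && T2 w' y).
  apply: contrapT => hn; apply: H => w'; apply/implyP => h'.
  by apply/negPn/negP => h; apply: hn; exists w'; rewrite h h'.
rewrite (bigD1 w') //= Ew Tw mulr1 lerDl.
by apply: sumr_ge0 => *; rewrite mulr_ge0.
Qed.

(* Splits the cost [e] as [e * Z + e * (1 - Z)], where [Z] is the weight of the
   codebook seen from [x], of mean close to 1 and small variance. *)
Let best_bound (F : {ffun C -> U}) x : cost F x (best F x) <=
  \sum_w a x w * k (F w) * miss F x w +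
  PX x * (eta + (1 - \sum_w a x w) + (\sum_w a x w * (1 - k (F w))) ^+ 2 / eta).
Proof.
set e := cost F x (best F x); set Y := \sum_w a x w * (1 - k (F w)).
set s := \sum_w a x w; set Z := \sum_w a x w * k (F w).
have -> : e = e * Z + e * (1 - Z) by ring.
have YE : Y = s - Z.
  by rewrite /Y /s /Z -sumrB; apply: eq_bigr => w _; ring.
apply: lerD.
  rewrite mulr_sumr; apply: ler_sum => w _.
  have [ak|ak] := ltP 0 (a x w * k (F w)); last first.
    have -> : a x w * k (F w) = 0 by apply/eqP; rewrite eq_le ak mulr_ge0.
    by rewrite mulr0 mul0r.
  rewrite mulrC ler_pM2l //; apply: le_trans (best_le F x w) _; exact: cost_miss.
(* If [Y <= eta] the first term suffices, otherwise [Y <= Y ^+ 2 / eta]; only a second moment then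
   remains to be estimated. *)
have Yle : Y <= eta + Y ^+ 2 / eta.
  rewrite -(ler_pM2r eta0) mulrDl divfK ?gt_eqF //; nra.
have s1 : s <= 1 := sum_a_le1 x.
have Y2 : 0 <= Y ^+ 2 / eta by rewrite divr_ge0 ?sqr_ge0 ?ltW.
apply: (@le_trans _ _ (e * (eta + (1 - s) + Y ^+ 2 / eta))).
  by apply: ler_wpM2l; [exact: cost_ge0 | lra].
apply: ler_wpM2r; last exact: cost_le.
by rewrite addr_ge0 // addr_ge0 ?subr_ge0 // ltW.
Qed.

Let ev_miss x w : ev (prodm u) (fun F : {ffun C -> U} => k (F w) * miss F x w) <=
  \sum_y P x y * ind (~~ T2 w y) + PX x * (N / (K.+1 * L.+1)%:R).
Proof.
rewrite /miss.
under eq_ev => F do rewrite mulr_sumr.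
rewrite ev_sum /PX mulr_suml -big_split /=; apply: ler_sum => y _.
under eq_ev => F do rewrite mulrCA mulrDr mulr_sumr.
rewrite evZ -mulrDr; apply: ler_wpM2l => //.
rewrite evD ev_sum.
under eq_ev => F do rewrite mulrC.
rewrite evZ ev_k mulr1 lerD2l.
apply: (@le_trans _ _ (\sum_w' ind (T2 w' y) * (K.+1 * L.+1)%:R^-1)); last first.
  by rewrite -mulr_suml ler_wpM2r ?invr_ge0.
rewrite [leRHS](bigID (fun w' => w' != w)) /= ler_wpDr //.
  by apply: sumr_ge0 => *; rewrite mulr_ge0 ?invr_ge0.
apply: ler_sum => w' ww.
under eq_ev => F do rewrite mulrCA.
by rewrite evZ ev_collide.
Qed.

(** Independence of the hashes leaves [K] times the sum of the squared weights; one factor of each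
    square is at most [theta], and the others sum to at most 1. *)
Let ev_square x : ev (prodm u) (fun F : {ffun C -> U} =>
  (\sum_w a x w * (1 - k (F w))) ^+ 2) <= K%:R * theta.
Proof.
rewrite /ev (variance_sum (g := fun w c => a x w * (1 - k c))) //; last first.
  move=> w; under eq_bigr => c _ do rewrite mulrCA mulrBr mulr1.
  by rewrite -mulr_sumr sumrB sum_first u1 subrr mulr0.
apply: (@le_trans _ _ (\sum_w K%:R * theta * a x w)); last first.
  by rewrite -mulr_sumr ler_piMr ?mulr_ge0 // sum_a_le1.
apply: ler_sum => w _.
under eq_bigr => c _ do rewrite exprMn mulrCA.
rewrite -mulr_sumr sum_variance mulrC -mulrA; apply: ler_wpM2l => //.
rewrite expr2; apply: ler_wpM2r => //.
by rewrite /a; have := @T1P w x; case: (T1 w x) => [/(_ isT)|_]; rewrite ?mulr1 // mulr0.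
Qed.

(** The five terms: [w] atypical for [x], [w] outside the list of [y], a collision inside that list,
    and two for the deviation of the codebook weight from 1. Averaging over [F] yields a fixed
    hash. *)
Lemma one_shot_coding : exists (F : {ffun C -> U}) (s : A -> C),
  \sum_x \sum_y P x y * ind (~~ decodable F (s x) x y) <=
  \sum_x \sum_w (\sum_y P x y) * q w x * ind (~~ T1 w x) +
  \sum_x \sum_w q w x * \sum_y P x y * ind (~~ T2 w y) +
  N / (K.+1 * L.+1)%:R + eta + K%:R * theta / eta.
Proof.
have [|F HF] := @ev_ex R _ (prodm u) (fun F : {ffun C -> U} => prodm_ge0 F u0) (sum_prodm C u1)
  (fun F => \sum_x cost F x (best F x))
  (\sum_x \sum_w PX x * q w x * ind (~~ T1 w x) +
  \sum_x \sum_w q w x * \sum_y P x y * ind (~~ T2 w y) +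
  N / (K.+1 * L.+1)%:R + eta + K%:R * theta / eta); last by exists F, (best F).
rewrite ev_sum.
have N0 : 0 <= N / (K.+1 * L.+1)%:R.
  rewrite divr_ge0 //; case: (pickP B) => [y _|B0].
    by apply: le_trans (T2P y); exact: sumr_ge0.
  by move: P1; rewrite big1 => [/eqP|x _]; rewrite ?(eq_sym 0) ?oner_eq0 // big_pred0.
apply: (@le_trans _ _ (\sum_x (\sum_w PX x * q w x * ind (~~ T1 w x) +
   \sum_w q w x * \sum_y P x y * ind (~~ T2 w y) +
   PX x * (N / (K.+1 * L.+1)%:R + eta + K%:R * theta / eta)))); last first.
  by rewrite !big_split /= -mulr_suml P1 mul1r -!addrA.
apply: ler_sum => x _.
apply: le_trans (ev_le (fun F => prodm_ge0 F u0) (best_bound ^~ x)) _.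
rewrite evD evZ !evD !(ev_cst (sum_prodm C u1)) ev_sum.
under [X in _ + _ * (_ + X)]eq_ev => F do rewrite mulrC.
rewrite evZ.
have h1 : \sum_w ev (prodm u) (fun F : {ffun C -> U} => a x w * k (F w) * miss F x w) <=
  \sum_w q w x * \sum_y P x y * ind (~~ T2 w y) + PX x * (N / (K.+1 * L.+1)%:R).
  apply: (@le_trans _ _ (\sum_w (q w x * \sum_y P x y * ind (~~ T2 w y) + q w x * (PX x * (N /
    (K.+1 * L.+1)%:R))))); last first.
    by rewrite big_split /= -mulr_suml q1 mul1r.
  apply: ler_sum => w _; under eq_ev => F do rewrite -mulrA.
  rewrite evZ -mulrDr.
  have t0 : 0 <= \sum_y P x y * ind (~~ T2 w y) + PX x * (N / (K.+1 * L.+1)%:R).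
    by apply: addr_ge0; [apply: sumr_ge0 => *; rewrite mulr_ge0 | exact: mulr_ge0].
  apply: (@le_trans _ _ (a x w * (\sum_y P x y * ind (~~ T2 w y) + PX x * (N / (K.+1 * L.+1)%:R)))).
    by apply: ler_wpM2l => //; exact: ev_miss.
  by apply: ler_wpM2r => //; rewrite /a ler_piMr //; case: (T1 w x).
have h2 : PX x * (1 - \sum_w a x w) = \sum_w PX x * q w x * ind (~~ T1 w x).
  rewrite -{1}(q1 x) -sumrB mulr_sumr; apply: eq_bigr => w _.
  by rewrite /a; case: (T1 w x) => /=; ring.
have h3 : PX x * (eta^-1 * ev (prodm u) (fun F : {ffun C -> U} =>
  (\sum_w a x w * (1 - k (F w))) ^+ 2)) <= PX x * (K%:R * theta / eta).
  by apply: ler_wpM2l => //; rewrite mulrC ler_wpM2r ?ev_square // invr_ge0 ltW.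
rewrite -h2.
set V := ev _ _ in h3 *; set S1 := \sum_j _ in h1 *; set S2 := \sum_w _ in h1 *.
set r := N / _ in h1 *; set s := \sum_w _; set t := K%:R * theta / eta in h3 *.
have -> : PX x * (eta + (1 - s) + eta^-1 * V) = PX x * eta + PX x * (1 - s) + PX x * (eta^-1 * V).
  by ring.
by rewrite !(mulrDr _ (_ + _)) !(mulrDr _ r); lra.
Qed.
End OneShot.

(** * Typical words and the i.i.d. source *)

Section IidCoding.
Variables (R : realType) (X Y W : finType) (p : X -> Y -> R) (Q : W -> X -> R).
Hypothesis p0 : forall x y, 0 <= p x y.
Hypothesis p1 : \sum_x \sum_y p x y = 1.
Hypothesis Q0 : forall w x, 0 <= Q w x.
Hypothesis Q1 : forall x, \sum_w Q w x = 1.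

Local Notation p3 := (fun c : W * (X * Y) => p c.2.1 c.2.2 * Q c.1 c.2.1).

Let p30 c : 0 <= p3 c. Proof. exact: mulr_ge0. Qed.

Let p31 : \sum_c p3 c = 1.
Proof.
rewrite -(pair_bigA _ (fun w (v : X * Y) => p v.1 v.2 * Q w v.1)) exchange_big /=.
under eq_bigr => v _ do rewrite -mulr_sumr Q1 mulr1.
by rewrite -p1 pair_bigA.
Qed.

Let gW (c : W * (X * Y)) : R := ln (Q c.1 c.2.1).
Let gY (c : W * (X * Y)) : R := - ln (recv p Q c.1 c.2.2).
(** [muW] is [- H(W|X)] and [muY] is [H(W|Y)]. *)
Let muW := \sum_c p3 c * gW c.
Let muY := \sum_c p3 c * gY c.

Let cmiE : cmi p Q = muW + muY.
Proof.
rewrite /cmi /muW /muY -big_split /=.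
rewrite -(pair_bigA _ (fun w (v : X * Y) => p v.1 v.2 * Q w v.1 * gW (w,
  v) + p v.1 v.2 * Q w v.1 * gY (w, v))) /=.
apply: eq_bigr => w _; rewrite pair_bigA /=; apply: eq_bigr => v _.
by rewrite -mulrDr.
Qed.

Lemma sum_recv_le1 y : \sum_w recv p Q w y <= 1.
Proof.
rewrite /recv -mulr_suml /joint exchange_big /=.
under eq_bigr => x _ do rewrite -mulr_sumr Q1 mulr1.
rewrite -/(marg p y); have [->|m0] := eqVneq (marg p y) 0; first by rewrite mul0r ler01.
by rewrite divff.
Qed.

(** Needed so that the exponential fixing the number of bins is at least 1 and the rounding costs
    only a factor 2. *)
Lemma cmi_ge0 : 0 <= cmi p Q.
Proof.
have term w x y : p x y * Q w x - p x y * recv p Q w y <=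
    p x y * Q w x * (ln (Q w x) - ln (recv p Q w y)).
  have r0 : 0 <= recv p Q w y by exact: recv_ge0.
  have [px|px] := ltP 0 (p x y); last first.
    have -> : p x y = 0 by apply/eqP; rewrite eq_le px p0.
    by rewrite !mul0r subrr.
  have [qx|qx] := ltP 0 (Q w x); last first.
    have -> : Q w x = 0 by apply/eqP; rewrite eq_le qx Q0.
    by rewrite mulr0 mul0r sub0r oppr_le0 mulr_ge0.
  have rx : 0 < recv p Q w y by exact: recv_gt0 px qx.
  rewrite -mulrBr -mulrA ler_pM2l //.
  have h : ln (recv p Q w y) - ln (Q w x) <= recv p Q w y / Q w x - 1.
    rewrite -ln_div ?posrE //; have := @le_ln1Dx R (recv p Q w y / Q w x - 1).
    by rewrite addrCA subrr addr0; apply; rewrite ltrBrDl subrr divr_gt0.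
  apply: (@le_trans _ _ (Q w x * (1 - recv p Q w y / Q w x))).
    by rewrite mulrBr mulr1 [X in _ <= _ - X]mulrC divfK // gt_eqF.
  by rewrite ler_pM2l //; lra.
apply: (@le_trans _ _ (\sum_w \sum_x \sum_y (p x y * Q w x - p x y * recv p Q w y))); last first.
  by apply: ler_sum => w _; apply: ler_sum => x _; apply: ler_sum => y _.
have -> : \sum_w \sum_x \sum_y (p x y * Q w x - p x y * recv p Q w y) =
   1 - \sum_x \sum_y p x y * \sum_w recv p Q w y.
  under eq_bigr => w _ do under eq_bigr => x _ do rewrite sumrB.
  under eq_bigr => w _ do rewrite sumrB.
  rewrite sumrB exchange_big /=; congr (_ - _).
    rewrite -p1; apply: eq_bigr => x _; rewrite exchange_big /=; apply: eq_bigr => y _.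
    by rewrite -mulr_sumr Q1 mulr1.
  rewrite exchange_big /=; apply: eq_bigr => x _; rewrite exchange_big /=.
  by apply: eq_bigr => y _; rewrite mulr_sumr.
rewrite subr_ge0 -p1; apply: ler_sum => x _; apply: ler_sum => y _.
by rewrite ler_piMr // sum_recv_le1.
Qed.

(** Two Chebyshev variances, and three exponential terms each bounded by [2 / eps / n]. *)
Definition coding_constant (eps : R) : R :=
  (\sum_c p3 c * (gW c - muW) ^+ 2) / eps ^+ 2 +
  (\sum_c p3 c * (gY c - muY) ^+ 2) / eps ^+ 2 + 6 / eps.

Section Block.
Variables (I : finType) (Z : eqType) (fn : {ffun I -> X} -> {ffun I -> Y} -> Z) (z0 : Z) (w0 : W).
Variable eps : R.
Hypothesis eps0 : 0 < eps.
Hypothesis I0 : (0 < #|I|)%N.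

Local Notation Pn x y := (\prod_i p (x i) (y i)).
Local Notation Qn w x := (\prod_i Q (w i) (x i)).
Local Notation Rn w y := (\prod_i recv p Q (w i) (y i)).

(* Sent along with the bin: a solvable edge has a potential, so the joint type of
   [(w, x)] together with [w] and [y] determines the type of [f (x, y)]. *)
Definition joint_type (w : {ffun I -> W}) (x : {ffun I -> X}) : {ffun W * X -> 'I_#|I|.+1} :=
  [ffun c => inord #|[set i | (w i, x i) == c]|].

Hypothesis fn_type : forall (w : {ffun I -> W}) (x x' : {ffun I -> X}) (y : {ffun I -> Y}),
  (forall i, 0 < Q (w i) (x i)) -> (forall i, 0 < Q (w i) (x' i)) ->
  (forall i, 0 < p (x i) (y i)) -> (forall i, 0 < p (x' i) (y i)) ->
  joint_type w x = joint_type w x' -> fn x y = fn x' y.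

Let n : R := #|I|%:R.
Let n_gt0 : 0 < n. Proof. by rewrite ltr0n. Qed.

(** One-sided typicality suffices: an upper bound on [P(w|x)] serves as [theta], and a lower bound
    on [P(w|y)] limits the size of the list. *)
Let typW (w : {ffun I -> W}) (x : {ffun I -> X}) := Qn w x <= expR (n * (muW + eps)).
Let typY (w : {ffun I -> W}) (y : {ffun I -> Y}) := expR (- (n * (muY + eps))) <= Rn w y.

Let sum3 (F : {ffun I -> W} -> {ffun I -> X} -> {ffun I -> Y} -> R) :
  \sum_w \sum_x \sum_y F w x y =
  \sum_(z : {ffun I -> W * (X * Y)})
     F [ffun i => (z i).1] [ffun i => (z i).2.1] [ffun i => (z i).2.2].
Proof.
under eq_bigr => w _ do rewrite sum_ffun_pair.
rewrite sum_ffun_pair; apply: eq_bigr => z _.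
by congr F; apply/ffunP => i; rewrite !ffunE.
Qed.

Let weightE (z : {ffun I -> W * (X * Y)}) :
  Pn [ffun i => (z i).2.1] [ffun i => (z i).2.2] * Qn [ffun i => (z i).1] [ffun i => (z i).2.1]
  = prodm p3 z.
Proof. by rewrite -big_split /=; apply: eq_bigr => i _; rewrite !ffunE. Qed.

Let atypW : \sum_(x : {ffun I -> X}) \sum_(w : {ffun I -> W}) (\sum_(y : {ffun I ->
  Y}) Pn x y) * Qn w x * ind (~~ typW w x) <=
  (\sum_c p3 c * (gW c - muW) ^+ 2) / eps ^+ 2 / n.
Proof.
apply: le_trans (@chebyshev_upper R I _ p3 gW muW eps p30 p31 erefl eps0 I0).
rewrite exchange_big /=.
under eq_bigr => w _ do under eq_bigr => x _ do rewrite -mulrA mulr_suml.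
rewrite sum3; apply: ler_sum => z _; rewrite mulrA weightE.
have Pz0 := prodm_ge0 z p30.
(* Words of mass 0 are set aside: with a vanishing factor, [ln] of the product is not the sum of the
   logarithms. *)
have [Pz|Pz] := ltP 0 (prodm p3 z); last first.
  have -> : prodm p3 z = 0 by apply/eqP; rewrite eq_le Pz Pz0.
  by rewrite !mul0r.
apply: ler_wpM2l => //; apply: ler_ind; rewrite /typW -ltNge -/n => h.
have pz := prodr_gt0_inv (fun i => p30 (z i)) Pz.
have qz i : 0 < Q (z i).1 (z i).2.1.
  by have [] := mulr_gt0_inv (p0 _ _) (Q0 _ _) (pz i).
have -> : \sum_i gW (z i) = ln (\prod_i Q ([ffun i => (z i).1] i) ([ffun i => (z i).2.1] i)).
  by rewrite ln_prod => [|i]; [apply: eq_bigr => i _; rewrite !ffunE | rewrite !ffunE].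
by rewrite -[leLHS]expRK ler_ln ?posrE ?expR_gt0 ?(ltW h) // (lt_trans _ h) ?expR_gt0.
Qed.

Let atypY : \sum_(x : {ffun I -> X}) \sum_(w : {ffun I -> W}) Qn w x * \sum_(y : {ffun I ->
  Y}) Pn x y * ind (~~ typY w y) <=
  (\sum_c p3 c * (gY c - muY) ^+ 2) / eps ^+ 2 / n.
Proof.
apply: le_trans (@chebyshev_upper R I _ p3 gY muY eps p30 p31 erefl eps0 I0).
rewrite exchange_big /=.
under eq_bigr => w _ do under eq_bigr => x _ do rewrite mulr_sumr.
rewrite sum3; apply: ler_sum => z _; rewrite mulrCA mulrA weightE.
have Pz0 := prodm_ge0 z p30.
have [Pz|Pz] := ltP 0 (prodm p3 z); last first.
  have -> : prodm p3 z = 0 by apply/eqP; rewrite eq_le Pz Pz0.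
  by rewrite !mul0r.
apply: ler_wpM2l => //; apply: ler_ind; rewrite /typY -ltNge -/n => h.
have pz := prodr_gt0_inv (fun i => p30 (z i)) Pz.
have rz i : 0 < recv p Q (z i).1 (z i).2.2.
  have [a b] := mulr_gt0_inv (p0 _ _) (Q0 _ _) (pz i).
  exact: (recv_gt0 p0 Q0 a b).
have -> : \sum_i gY (z i) = - ln (\prod_i recv p Q ([ffun i => (z i).1] i) ([ffun i =>
  (z i).2.2] i)).
  rewrite ln_prod => [|i]; last by rewrite !ffunE.
  by rewrite -sumrN; apply: eq_bigr => i _; rewrite !ffunE.
rewrite lerNr -[leRHS]expRK ler_ln ?posrE ?expR_gt0 ?(ltW h) //.
by apply: prodr_gt0 => i _; rewrite !ffunE.
Qed.

(** Each typical word has weight at least [expR (- t)], and the weights total at most 1. *)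
Let count_typY y : \sum_w ind (typY w y) <= expR (n * (muY + eps)).
Proof.
set t := n * (muY + eps).
have -> : \sum_w ind (typY w y) = expR t * \sum_w expR (- t) * ind (typY w y) :> R.
  by rewrite -mulr_sumr mulrA expRxMexpNx_1 mul1r.
rewrite ger_pMr ?expR_gt0 //.
apply: (@le_trans _ _ (\sum_(w : {ffun I -> W}) Rn w y)).
  apply: ler_sum => w _; rewrite /typY; rewrite -/t; have [h|_] := boolP (expR (- t) <= Rn w y);
    rewrite ?mulr1 ?mulr0 //.
  by apply: prodr_ge0 => i _; exact: recv_ge0.
rewrite -(bigA_distr_bigA (fun i w => recv p Q w (y i))).
apply: prodr_ile1 => i _; rewrite sum_recv_le1 andbT.
by apply: sumr_ge0 => w _; exact: recv_ge0.
Qed.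

Let Pn1 : \sum_(x : {ffun I -> X}) \sum_(y : {ffun I -> Y}) Pn x y = 1.
Proof.
rewrite sum_ffun_pair; transitivity (\sum_(z : {ffun I -> X * Y}) prodm (fun c => p c.1 c.2) z).
  by apply: eq_bigr => z _; apply: eq_bigr => i _; rewrite !ffunE.
by apply: sum_prodm; rewrite -p1 pair_bigA.
Qed.

Let Qn1 (x : {ffun I -> X}) : \sum_(w : {ffun I -> W}) Qn w x = 1.
Proof.
rewrite -(bigA_distr_bigA (fun i w => Q w (x i))).
by apply: big1 => i _.
Qed.

(** The decoder takes any pair [(w', x')] consistent with the message and [y]. When [s x] is
    decodable, [w' = s x] is forced; [x'] may differ from [x], but the joint types agree and
    [fn_type] gives the same value. *)
Let code_of_hash (K L : nat) (F : {ffun {ffun I -> W} -> 'I_K.+1 * 'I_L.+1}) s :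
  exists (phi : {ffun I -> X} -> 'I_L.+1 * {ffun W * X -> 'I_#|I|.+1}) psi,
  error_mass p phi psi fn <= \sum_(x : {ffun I -> X}) \sum_(y : {ffun I -> Y})
     Pn x y * ind (~~ decodable (fun (w : {ffun I -> W}) (x : {ffun I -> X}) =>
       Qn w x) typY F (s x) x y).
Proof.
pose phi x := ((F (s x)).2, joint_type (s x) x).
pose ok m (y : {ffun I -> Y}) (wx : {ffun I -> W} * {ffun I -> X}) :=
  [&& (F wx.1).1 == ord0, (F wx.1).2 == m.1, typY wx.1 y, joint_type wx.1 wx.2 == m.2,
      0 < Qn wx.1 wx.2 & 0 < Pn wx.2 y].
pose psi m y := if [pick wx | ok m y wx] is Some wx then fn wx.2 y else z0.
exists phi, psi; apply: ler_sum => x _; apply: ler_sum => y _.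
have P0 : 0 <= Pn x y by exact: prodr_ge0.
have [Pp|Pp] := ltP 0 (Pn x y); last first.
  have -> : Pn x y = 0 by apply/eqP; rewrite eq_le Pp P0.
  by rewrite !mul0r.
apply: ler_wpM2l => //; apply: ler_ind; apply: contraNN.
case/and4P => Qp F1 Ty /forallP uniq.
rewrite /psi; case: pickP => [[w' x'] /and5P[/= e1 e2 Ty' jt /andP[Qp' Pp']]|/(_ (s x, x))];
  last first.
  by rewrite /ok /= F1 eqxx Ty eqxx Qp Pp.
have ww : w' = s x.
  have := uniq w'; rewrite Ty' andbT => /implyP h; apply/eqP; apply: h.
  by rewrite -pair_eqE /pair_eq /= (eqP e1) (eqP F1) e2 eqxx.
rewrite -(@fn_type (s x) x x' y) ?eqxx //.
- exact: (prodr_gt0_inv (F := fun i => Q (s x i) (x i))).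
- by rewrite -ww; exact: (prodr_gt0_inv (F := fun i => Q (w' i) (x' i))).
- exact: (prodr_gt0_inv (F := fun i => p (x i) (y i))).
- exact: (prodr_gt0_inv (F := fun i => p (x' i) (y i))).
- by rewrite -{2}ww; exact/esym/eqP.
Qed.

Lemma iid_coding : exists L
  (phi : {ffun I -> X} -> 'I_L.+1 * {ffun W * X -> 'I_#|I|.+1}) psi,
  error_mass p phi psi fn <= coding_constant eps / #|I|%:R /\
  ln (L.+1%:R) <= ln 2 + #|I|%:R * (cmi p Q + 4 * eps).
Proof.
(* Exponents over [n]: with [eta] of exponent [- eps / 2], collisions get [(muY + eps) - (- muW - 2
   eps) - (cmi + 4 eps) = - eps], and the second moment term gets [(- muW - 2 eps) + (muW + eps) +
   eps / 2 = - eps / 2]. *)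
pose K := Num.truncn (expR (n * (- muW - 2 * eps))).
pose L := Num.truncn (expR (n * (cmi p Q + 4 * eps))).
have /andP[K1 K2] : K%:R <= expR (n * (- muW - 2 * eps)) < K.+1%:R.
  by apply: Num.Theory.truncn_itv; exact: expR_ge0.
have /andP[L1 L2] : L%:R <= expR (n * (cmi p Q + 4 * eps)) < L.+1%:R.
  by apply: Num.Theory.truncn_itv; exact: expR_ge0.
have e20 : 0 < n * eps / 2 by rewrite divr_gt0 // mulr_gt0.
have eta_le : expR (- (n * eps / 2)) <= 2 / eps / n.
  apply: le_trans (expRN_le_inv e20) _.
  rewrite le_eqVlt; apply/orP; left; apply/eqP.
  by field; rewrite ?(gt_eqF eps0) ?(gt_eqF n_gt0).
have expNe : expR (- (n * eps)) <= expR (- (n * eps / 2)).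
  by rewrite ler_expR; have := mulr_gt0 n_gt0 eps0; lra.
have Pn0 (x : {ffun I -> X}) (y : {ffun I -> Y}) : 0 <= Pn x y by exact: prodr_ge0.
have Qn0 (w : {ffun I -> W}) (x : {ffun I -> X}) : 0 <= Qn w x by exact: prodr_ge0.
have [] := @one_shot_coding R _ _ {ffun I -> W} (fun (x : {ffun I -> X}) (y : {ffun I -> Y}) =>
  Pn x y)
  (fun (w : {ffun I -> W}) (x : {ffun I -> X}) => Qn w x)
  Pn0 Pn1 Qn0 Qn1 typW typY K L
  (expR (n * (muW + eps))) (expR (n * (muY + eps))) (expR (- (n * eps / 2))) (expR_gt0 _)
    (expR_ge0 _)
  (fun w x h => h) count_typY [ffun=> w0].
move=> F [s Fs].
have [phi [psi phis]] := code_of_hash F s.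
exists L, phi, psi; split; last first.
  apply: (@le_trans _ _ (ln (2 * expR (n * (cmi p Q + 4 * eps))))).
    rewrite ler_ln ?posrE ?ltr0n ?mulr_gt0 ?expR_gt0 //.
    rewrite -natr1; have : 1 <= expR (n * (cmi p Q + 4 * eps)).
      apply: le_trans (expR_ge1Dx _); rewrite lerDl mulr_ge0 ?(ltW n_gt0) //.
      by rewrite addr_ge0 ?cmi_ge0 // mulr_ge0 // ltW.
    by lra.
  by rewrite lnM ?posrE ?expR_gt0 // expRK.
apply: (le_trans phis); apply: (le_trans Fs).
have b1 : expR (n * (muY + eps)) / (K.+1 * L.+1)%:R <= expR (- (n * eps)).
  rewrite ler_pdivrMr; last by rewrite ltr0n.
  rewrite natrM; apply: (@le_trans _ _ (expR (- (n * eps)) * (expR (n * (- muW - 2 * eps)) * expR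
    (n * (cmi p Q + 4 * eps))))).
    by rewrite -!expRD ler_expR cmiE le_eqVlt; apply/orP; left; apply/eqP; ring.
  apply: ler_wpM2l; first exact: expR_ge0.
  by apply: ler_pM; rewrite ?expR_ge0 // ltW.
have b2 : K%:R * expR (n * (muW + eps)) / expR (- (n * eps / 2)) <= expR (- (n * eps / 2)).
  rewrite ler_pdivrMr ?expR_gt0 // -expRD.
  apply: (@le_trans _ _ (expR (n * (- muW - 2 * eps)) * expR (n * (muW + eps)))).
    by apply: ler_wpM2r => //; exact: expR_ge0.
  by rewrite -expRD ler_expR le_eqVlt; apply/orP; left; apply/eqP; field.
have -> : coding_constant eps / #|I|%:R =
   (\sum_c p3 c * (gW c - muW) ^+ 2) / eps ^+ 2 / n + (\sum_c p3 c * (gY c - muY) ^+ 2) / eps ^+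
     2 / n
   + 3 * (2 / eps / n).
  by rewrite /coding_constant -/n; field; rewrite ?(gt_eqF eps0) ?(gt_eqF n_gt0).
have -> : 3 * (2 / eps / n) = 2 / eps / n + 2 / eps / n + 2 / eps / n by ring.
rewrite !addrA; apply: lerD; last exact: le_trans b2 eta_le.
apply: lerD => //; apply: lerD; last exact: le_trans b1 (le_trans expNe eta_le).
exact: lerD atypW atypY.
Qed.
End Block.
End IidCoding.

(** * Loops and potentials *)

Lemma subseq_cons2 (T : eqType) (z : T) s t : subseq s t -> subseq (z :: s) (z :: t).
Proof. by rewrite /= eqxx. Qed.

Section Potential.
Variables (R : realType) (X Y : finType).
Implicit Types (E S : seq (X * Y)) (a : seq X) (b : seq Y).

Lemma sum_zip_potential (al : X -> R) (be : Y -> R) a b : size a = size b ->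
  \sum_(c <- zip a b) (al c.1 + be c.2) = \sum_(x <- a) al x + \sum_(y <- b) be y.
Proof.
move=> ab; rewrite big_split /=; congr (_ + _).
  by rewrite -[in RHS](@unzip1_zip _ _ a b) ?ab // big_map.
by rewrite -[in RHS](@unzip2_zip _ _ a b) ?ab // big_map.
Qed.

Definition adjacent E (u v : X + Y) : bool :=
  match u, v with
  | inl x, inr y => (x, y) \in E
  | inr y, inl x => (x, y) \in E
  | _, _ => false
  end.

(** The path reads [x, y1, x1, ..., y]: its edges from left to right pair [x :: a] with [rcons b y],
    the others pair [a] with [b]. The [subseq] clauses carry uniqueness from the path to both
    lists. *)
Lemma alternating_path E p x y : path (adjacent E) (inl x) p -> last (inl x) p = inr y ->
  exists a b, [/\ size a = size b, subseq (map inl (x :: a)) (inl x :: p),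
    subseq (map inr (rcons b y)) p, {subset zip (x :: a) (rcons b y) <= E} &
    {subset zip a b <= E}].
Proof.
have [N] := ubnP (size p); elim: N p x => // N IH p x.
case: p => [|[x'|y1] [|[x1|y'] p]] //=.
- by move=> _ /andP[e _] [<-]; exists [::], [::]; split => //=;
  [rewrite eqxx | rewrite eqxx | move=> c; rewrite inE => /eqP ->].
- rewrite ltnS => pN /and3P[e1 e2 pp] pl.
  have [|a [b [s1 s2 s3 s4 s5]]] := IH p x1 _ pp pl; first exact: ltn_trans (ltnSn _) pN.
  exists (x1 :: a), (y1 :: b); split; first by rewrite /= s1.
  + exact: subseq_cons2 (subseq_trans s2 (subseq_cons _ _)).
  + exact: subseq_cons2 (subseq_trans s3 (subseq_cons _ _)).
  + by move=> c; rewrite inE => /orP[/eqP -> //|]; exact: s4.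
  + by move=> c; rewrite inE => /orP[/eqP -> //|]; exact: s5.
- by rewrite andbF.
Qed.

(* Edges are added one at a time: an edge closing a simple cycle is handled by the
   hypothesis, and an edge joining two components by shifting the potential on
   one of them. *)
Lemma potential_exists S (d : X * Y -> R) :
  (forall a b, size a = size b -> uniq a -> uniq b ->
     {subset zip a b <= S} -> {subset zip a (rot 1 b) <= S} ->
     \sum_(c <- zip a b) d c = \sum_(c <- zip a (rot 1 b)) d c) ->
  exists al be, forall c, c \in S -> d c = al c.1 + be c.2.
Proof.
move=> bal.
suff H E : {subset E <= S} -> exists al be, forall c, c \in E -> d c = al c.1 + be c.2.
  exact: H.
elim: E => [_|[x0 y0] E IH sub]; first by exists (fun=> 0), (fun=> 0).
have subE : {subset E <= S} by move=> c cE; apply: sub; rewrite inE cE orbT.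
have xyS : (x0, y0) \in S by apply: sub; rewrite mem_head.
have [al [be H]] := IH subE.
have [/connectP[p0 pp0 pl0]|nc] := boolP (connect (adjacent E) (inl x0) (inr y0)).
- exists al, be => c; rewrite inE => /orP[/eqP -> /=|]; last exact: H.
  case/shortenP: pp0 pl0 => p pp pu _ pl.
  have [a [b [s1 s2 s3 s4 s5]]] := alternating_path pp (esym pl).
  (* With [y0] in front, the new edge is the head of the first matching; every other edge of the
     loop lies on the path, where the potential is known. *)
  have rotE : rot 1 (y0 :: b) = rcons b y0 by rewrite rot1_cons.
  have ua : uniq (x0 :: a) by have := subseq_uniq s2 pu; apply: map_uniq.
  have ub : uniq (y0 :: b).
    rewrite -(rot_uniq 1) rotE; apply: (@map_uniq _ _ inr).
    by apply: subseq_uniq s3 _; case/andP: pu.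
  have sab : size (x0 :: a) = size (y0 :: b) by rewrite /= s1.
  have S1 : {subset zip (x0 :: a) (y0 :: b) <= S}.
    by move=> z; rewrite inE => /orP[/eqP -> //|/s5/subE].
  have S2 : {subset zip (x0 :: a) (rot 1 (y0 :: b)) <= S}.
    by move=> z; rewrite rotE => /s4/subE.
  have := bal _ _ sab ua ub S1 S2; rewrite rotE.
  have sumE (u : seq X) (v : seq Y) : size u = size v -> {subset zip u v <= E} ->
      \sum_(c <- zip u v) d c = \sum_(x <- u) al x + \sum_(y <- v) be y.
    move=> uv ss; rewrite -sum_zip_potential //; apply: eq_big_seq => z zuv.
    by apply: H; exact: ss.
  rewrite big_cons (sumE _ _ s1 s5) (sumE (x0 :: a)) ?size_rcons /= ?s1 //.
  by rewrite big_cons big_rcons /=; lra.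
(* [k] is the defect on the new edge. Adding it to [al] and subtracting it from [be] on the
   component of [x0] leaves the old edges unaffected. *)
- pose k := d (x0, y0) - al x0 - be y0.
  pose C u := connect (adjacent E) (inl x0) u.
  exists (fun x => al x + k * ind (C (inl x))), (fun y => be y - k * ind (C (inr y))).
  case=> x y; rewrite inE => /orP[/eqP[-> ->]|xyE] /=.
    by rewrite /C connect0 (negbTE nc) mulr1 mulr0 subr0 /k; ring.
  have -> : C (inl x) = C (inr y).
    apply/idP/idP => h; apply: connect_trans h _; exact: connect1.
  by rewrite (H _ xyE) /=; ring.
Qed.

Section Balanced.
Variables (S : X -> Y -> bool) (f : X -> Y -> nat).

Definition balanced (e : {set X}) : Prop :=
  forall a b, size a = size b -> uniq a -> uniq b ->
  (forall c, c \in zip a b -> c.1 \in e /\ S c.1 c.2) ->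
  (forall c, c \in zip a (rot 1 b) -> c.1 \in e /\ S c.1 c.2) ->
  forall v, count (fun c => f c.1 c.2 == v) (zip a b) =
            count (fun c => f c.1 c.2 == v) (zip a (rot 1 b)).

Definition has_potential (e : {set X}) : Prop :=
  forall v, exists (al : X -> R) (be : Y -> R),
  forall x y, x \in e -> S x y -> ind (f x y == v) = al x + be y.

Let countE (s : seq (X * Y)) v :
  (count (fun c => f c.1 c.2 == v) s)%:R = \sum_(c <- s) ind (f c.1 c.2 == v) :> R.
Proof.
by elim: s => [|c s IH]; rewrite ?big_nil // big_cons /= natrD IH.
Qed.

(** From potentials to balance: both matchings of a loop use each letter once, so rotating [b]
    leaves the sums of [al] and [be] unchanged. The other direction is [potential_exists] on the
    support above [e]. *)
Lemma balancedP e : balanced e <-> has_potential e.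
Proof.
split=> [bal v|pot a b ab ua ub h1 h2 v].
- have [|al [be H]] := @potential_exists (enum [pred c | (c.1 \in e) && S c.1 c.2])
    (fun c => ind (f c.1 c.2 == v)); last first.
    by exists al, be => x y xe Sxy; rewrite -(H (x, y)) // mem_enum inE xe.
  move=> a b ab ua ub h1 h2; rewrite -!countE; congr (_%:R); apply: bal => // c.
    by move/h1; rewrite mem_enum => /andP[].
  by move/h2; rewrite mem_enum => /andP[].
- have [al [be H]] := pot v.
  have sumE (u : seq X) (w : seq Y) : size u = size w ->
      (forall c, c \in zip u w -> c.1 \in e /\ S c.1 c.2) ->
      (count (fun c => f c.1 c.2 == v) (zip u w))%:R = \sum_(x <- u) al x + \sum_(y <- w) be y.
    move=> uw hh; rewrite countE -sum_zip_potential //; apply: eq_big_seq => c cuw.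
    by have [h h'] := hh c cuw; apply: H.
  apply/eqP; rewrite -(eqr_nat R) (sumE _ _ ab h1) (sumE _ _ _ h2) ?size_rot //.
  apply/eqP; congr (_ + _); apply/esym/perm_big; by rewrite perm_rot.
Qed.
End Balanced.
End Potential.

(** * Types of the function values *)

Section TypeFunction.
Variables (R : realType) (I X Y : finType) (S : X -> Y -> bool) (f : X -> Y -> nat).

Definition type_count (x : {ffun I -> X}) (y : {ffun I -> Y}) v : nat :=
  \sum_i (f (x i) (y i) == v).

(** An additive functional sees only the joint type. [inord] loses nothing, as counts never exceed
    [#|I|]. *)
Lemma joint_type_sum (W : finType) (w : {ffun I -> W}) (x : {ffun I -> X}) (A : W -> X -> R) :
  \sum_i A (w i) (x i) = \sum_c (joint_type w x c)%:R * A c.1 c.2.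
Proof.
rewrite (partition_big (fun i => (w i, x i)) xpredT) //=; apply: eq_bigr => c _.
rewrite ffunE inordK ?ltnS ?max_card // mulr_natl -sumr_const.
by apply: eq_big => [i|i /eqP <- //]; rewrite inE.
Qed.

(** With a potential chosen for each edge, the count of [v] is a sum over [(w i, x i)], fixed by the
    joint type, plus a sum over [(w i, y i)], which does not involve [x]. *)
Lemma type_count_joint_type (w : {ffun I -> {set X}}) (x x' : {ffun I -> X}) (y : {ffun I -> Y}) v :
  (forall i, balanced S f (w i)) ->
  (forall i, x i \in w i) -> (forall i, x' i \in w i) ->
  (forall i, S (x i) (y i)) -> (forall i, S (x' i) (y i)) ->
  joint_type w x = joint_type w x' -> type_count x y v = type_count x' y v.
Proof.
move=> bal xw xw' Sx Sx' jt.
pose ok e (u : (X -> R) * (Y -> R)) := balanced S f e ->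
  forall x y, x \in e -> S x y -> (f x y == v)%:R = u.1 x + u.2 y.
have /choice[u uP] : forall e, exists u, ok e u.
  move=> e; have [/(balancedP R) pot|nb] := pselect (balanced S f e).
    by have [al [be H]] := pot v; exists (al, be) => _; exact: H.
  by exists (fun=> 0, fun=> 0).
have cE (z : {ffun I -> X}) : (forall i, z i \in w i) -> (forall i, S (z i) (y i)) ->
    (type_count z y v)%:R = \sum_i (u (w i)).1 (z i) + \sum_i (u (w i)).2 (y i).
  move=> zw Sz; rewrite natr_sum -big_split /=; apply: eq_bigr => i _.
  exact: uP.
apply/eqP; rewrite -(eqr_nat R) !cE //.
by rewrite !(joint_type_sum w _ (fun e => (u e).1)) jt.
Qed.

Variables (M : finType) (Z : eqType) (p : X -> Y -> R).
Variables (phi : {ffun I -> X} -> M) (psi : M -> {ffun I -> Y} -> Z).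
Variables (fn : {ffun I -> X} -> {ffun I -> Y} -> Z) (K : pred nat) (g : nat -> Z -> R).
Hypothesis fn_count : forall x y v, K v -> g v (fn x y) = (type_count x y v)%:R.
Hypothesis fK : forall x y, K (f x y).

(** The potential is explicit. The decoded count of [v] depends on [b] alone; the count off position
    [i] depends on [a] alone, through a witness word [xx a] valid for every [b] of positive mass;
    their difference is the indicator of [f a b = v]. Values outside [K] never occur. *)
Lemma confusable_balanced i m y :
  balanced (fun x y => 0 < p x y) f (confusable p phi psi fn i m y).
Proof.
apply/(balancedP R) => v; have [Kv|Kv] := boolP (K v); last first.
  exists (fun=> 0), (fun=> 0) => x y' _ _; rewrite addr0; case: eqP => // E.
  by move: Kv; rewrite -E fK.
have /choice[xx xxP] : forall a, exists x : {ffun I -> X}, a \in confusable p phi psi fn i m y ->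
   x i = a /\ forall b, 0 < p a b -> psi m (upd y i b) = fn x (upd y i b).
  move=> a; have [ha|ha] := boolP (a \in confusable p phi psi fn i m y); last first.
    by exists [ffun=> a].
  move: (ha); rewrite inE => /existsP[x /and3P[/eqP e1 /eqP e2 /forallP e3]].
  by exists x => _; split=> // b pb; apply/eqP; have := e3 b; rewrite pb.
exists (fun a => - \sum_(j | j != i) (f (xx a j) (y j) == v)%:R),
  (fun b => g v (psi m (upd y i b))) => a b ha pb.
have [xa xb] := xxP a ha.
rewrite xb // fn_count //.
have -> : (type_count (xx a) (upd y i b) v)%:R =
    (f a b == v)%:R + \sum_(j | j != i) (f (xx a j) (y j) == v)%:R :> R.
  rewrite /type_count (bigD1 i) //= natrD xa upd_at natr_sum; congr (_ + _).
  by apply: eq_bigr => j ji; rewrite upd_ne.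
by rewrite addrC addrK.
Qed.
End TypeFunction.

(** * The minimum is attained *)

Local Open Scope classical_set_scope.
Local Open Scope ring_scope.

Section EntropyFunction.
Variable R : realType.

(** With [s] the square root of [t], [t ln t = 2 s^2 ln s] and [- ln s <= 1 / s]. This settles
    continuity at 0. *)
Lemma xlnx_bound (t : R) : `|t| <= 1 -> `|t * ln t| <= 2 * Num.sqrt `|t|.
Proof.
have [t0 _|t0] := leP t 0; first by rewrite (ln0 t0) mulr0 normr0 mulr_ge0 // sqrtr_ge0.
rewrite (gtr0_norm t0) => t1; set s := Num.sqrt t.
have s0 : 0 < s by rewrite sqrtr_gt0.
have ts : t = s * s by rewrite -expr2 sqr_sqrtr // ltW.
have l0 : ln t <= 0 by exact: ln_le0.
rewrite normrM (gtr0_norm t0) (ler0_norm l0).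
have h : - ln s <= s^-1 by rewrite -lnV ?posrE // ltW // ln_sublinear // invr_gt0.
rewrite {2}ts lnM ?posrE // opprD.
have : s * s * (- ln s) <= s * s * s^-1 by rewrite ler_pM2l // mulr_gt0.
by rewrite mulfK ?gt_eqF // {1}ts; lra.
Qed.

Lemma continuous_xlnx : continuous (fun t : R => t * ln t).
Proof.
move=> x; have [x0|x0|->] := ltgtP x 0.
- apply/cvgrPdist_lt => e e0; near=> t.
  have t0 : t <= 0.
    by apply: ltW; near: t; exact: lt_nbhsl.
  by rewrite (ln0 t0) (ln0 (ltW x0)) !mulr0 subrr normr0.
- by apply: cvgM; [exact: cvg_id | exact: continuous_ln].
- apply/cvgrPdist_lt => e e0; near=> t.
  rewrite mul0r sub0r normrN.
  have t1 : `|t| < Num.min 1 ((e / 2) ^+ 2).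
    rewrite -[t]subr0 distrC; near: t.
    apply: cvgr_dist_lt; first exact: cvg_id.
    by rewrite lt_min ltr01 exprn_gt0 // divr_gt0.
  move: t1; rewrite lt_min => /andP[t1 t2].
  apply: le_lt_trans (xlnx_bound (ltW t1)) _.
  have e2 : 0 < e / 2 by rewrite divr_gt0.
  have : Num.sqrt `|t| < Num.sqrt ((e / 2) ^+ 2) by rewrite ltr_sqrt // exprn_gt0.
  by rewrite sqrtr_sqr (gtr0_norm e2); lra.
Unshelve. all: by end_near. Qed.

Lemma continuous_bigsum (T : topologicalType) (J : Type) (r : seq J) (F : J -> T -> R) :
  (forall j, continuous (F j)) -> continuous (fun t => \sum_(j <- r) F j t).
Proof.
move=> cF; elim: r => [|j r IH] t.
  under eq_fun do rewrite big_nil.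
  exact: cvg_cst.
under eq_fun do rewrite big_cons.
by apply: cvgD; [exact: cF | exact: IH].
Qed.
End EntropyFunction.

(** * Compactness of the feasible channels *)

Section MinimalChannel.
Variables (R : realType) (X Y W : finType) (p : X -> Y -> R) (ok : W -> X -> Prop).
Hypothesis p0 : forall x y, 0 <= p x y.

Definition feasible (Q : W -> X -> R) : Prop :=
  [/\ forall w x, 0 <= Q w x, forall x, \sum_w Q w x = 1 &
      forall w x, ~ ok w x -> Q w x = 0].

Definition entropies (Q : W -> X -> R) : R :=
  \sum_w \sum_x (\sum_y p x y) * (Q w x * ln (Q w x)) -
  \sum_w \sum_y (joint p Q w y * ln (joint p Q w y) - joint p Q w y * ln (marg p y)).

Lemma continuous_entropies (T : topologicalType) (g : W -> X -> T -> R) :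
  (forall w x, continuous (g w x)) ->
  continuous (fun t => entropies (fun w x => g w x t)).
Proof.
move=> cg.
have cjoint w y : continuous (fun t => joint p (fun w x => g w x t) w y).
  apply: (@continuous_bigsum R T X (index_enum X) (fun x t => p x y * g w x t)) => x t.
  by apply: cvgM; [exact: cvg_cst | exact: cg].
have cxl (h : T -> R) : continuous h -> continuous (fun t => h t * ln (h t)).
  move=> ch t; apply: (@continuous_comp _ _ _ h (fun s => s * ln s)); first exact: ch.
  exact: continuous_xlnx.
move=> t; apply: cvgB.
  apply: continuous_bigsum => w {}t; apply: continuous_bigsum => x {}t.
  by apply: cvgM; [exact: cvg_cst | apply: cxl; exact: cg].
apply: continuous_bigsum => w {}t; apply: continuous_bigsum => y {}t.
by apply: cvgB; [exact: cxl | apply: cvgM; [exact: cjoint | exact: cvg_cst]].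
Qed.

(* With [ln 0 = 0], [t * ln t] is continuous everywhere, unlike the logarithms of
   ratios in [cmi]. *)
Lemma cmi_entropies (Q : W -> X -> R) : (forall w x, 0 <= Q w x) ->
  cmi p Q = entropies Q.
Proof.
move=> Q0; rewrite /cmi /entropies -sumrB; apply: eq_bigr => w _.
under eq_bigr => x _ do under eq_bigr => y _ do rewrite mulrBr.
under eq_bigr => x _ do rewrite sumrB.
rewrite sumrB; congr (_ - _).
  apply: eq_bigr => x _; rewrite mulr_suml; apply: eq_bigr => y _.
  by rewrite mulrA.
rewrite exchange_big /=; apply: eq_bigr => y _.
rewrite -mulr_suml -/(joint p Q w y) -mulrBr.
have [J0|J0] := ltP 0 (joint p Q w y); last first.
  have -> : joint p Q w y = 0 by apply/eqP; rewrite eq_le J0 joint_ge0.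
  by rewrite !mul0r.
have m0 : 0 < marg p y.
  rewrite lt_neqAle marg_ge0 // andbT eq_sym; apply/eqP => m0.
  move: J0; rewrite /joint big1 ?ltxx // => x _.
  have -> : p x y = 0 by apply/eqP; rewrite eq_le p0 -m0 marg_ge.
  by rewrite mul0r.
by rewrite /recv ln_div ?posrE.
Qed.

(** Feasible channels form a compact set: a product of segments [[0, 1]] at allowed cells and points
    0 elsewhere, cut by the closed normalisation conditions. The extreme value theorem applies to
    [entropies]. *)
Lemma cmi_min_exists : (exists Q : W -> X -> R, feasible Q) ->
  exists Q : W -> X -> R, feasible Q /\ forall Q', feasible Q' -> cmi p Q <= cmi p Q'.
Proof.
move=> [Q1 [Q10 Q1s Q1ok]].
pose T := prod_topology (fun _ : W * X => R : topologicalType).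
pose un (q : T) : W -> X -> R := fun w x => q (w, x).
pose B (c : W * X) : set R := if `[< ok c.1 c.2 >] then [set` `[0, 1]%R] else [set 0].
pose A : set T := [set q | forall c, B c (q c)] `&`
  \bigcap_(x in [set: X]) [set q : T | \sum_w q (w, x) = 1].
pose J (q : T) := entropies (un q).
have cproj c : continuous (fun q : T => q c) by exact: proj_continuous.
have cJ : continuous J.
  exact: (@continuous_entropies T (fun w x q => q (w, x)) (fun w x => cproj (w, x))).
have cA : compact A.
  apply: compact_closedI.
    apply: tychonoff => c; rewrite /B; case: asboolP => _; first exact: segment_compact.
    exact: compact_set1.
  apply: closed_bigI => x _.
  apply: (@preimage_closed T R (fun q => \sum_w q (w, x)) [set 1]) (@closed_eq R 1).
  by move=> q _; exact: (@continuous_bigsum R T W (index_enum W) (fun w q => q (w, x)) (fun w =>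
    cproj (w, x)) q).
have inA (Q : W -> X -> R) : feasible Q -> A (fun c => Q c.1 c.2).
  move=> [Qp Qs Qok]; split; last by move=> x _; exact: Qs.
  move=> [w x]; rewrite /B /=; case: asboolP => h; last exact: Qok.
  rewrite /= in_itv /= Qp /= -(Qs x) (bigD1 w) //= lerDl.
  exact: sumr_ge0.
have Af q : A q -> feasible (un q).
  move=> [qB qs]; split.
  - move=> w x; have := qB (w, x); rewrite /B /=; case: asboolP => _ /=.
      by rewrite in_itv /= => /andP[].
    by rewrite /un => ->.
  - by move=> x; exact: qs.
  - by move=> w x h; have := qB (w, x); rewrite /B /=; case: asboolP.
have JE q : A q -> cmi p (un q) = J q by move=> /Af[q0 _ _]; exact: cmi_entropies.
have A0 : A !=set0 by exists (fun c => Q1 c.1 c.2); apply: inA.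
have [q qA qmin] := compact_EVT_min A0 cA (continuous_subspaceT cJ).
move/set_mem in qA; exists (un q); split; first exact: Af.
move=> Q' fQ'; rewrite JE //.
have AQ' := inA _ fQ'; have := qmin _ (mem_set AQ').
by rewrite -(JE _ AQ').
Qed.
End MinimalChannel.

(** * Lists and finite types *)

Section ListTranslation.

Lemma lsumE (A : Type) (l : seq A) (F : A -> R) : lsum l F = \sum_(i <- l) F i.
Proof. by elim: l => [|i l IH]; rewrite ?big_nil // big_cons -IH. Qed.

Lemma seqE k n : List.seq k n = iota k n.
Proof. by elim: n k => // n IH k /=; rewrite IH. Qed.

Lemma lsum_seq k (F : nat -> R) : lsum (List.seq 0 k) F = \sum_(i < k) F i.
Proof. by rewrite lsumE seqE -(big_mkord xpredT) /index_iota subn0. Qed.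

Lemma InP (A : eqType) (x : A) (l : seq A) : reflect (List.In x l) (x \in l).
Proof.
apply: (iffP idP); elim: l => //= y l IH; rewrite inE.
  by case/orP => [/eqP ->|/IH]; [left | right].
by case=> [->|/IH ->]; rewrite ?eqxx ?orbT.
Qed.

Lemma NoDupP (A : eqType) (l : seq A) : reflect (List.NoDup l) (uniq l).
Proof.
apply: (iffP idP) => [|nd].
  elim: l => [|x l IH] /=; first by constructor.
  by case/andP => xl ul; constructor; [move/InP; apply/negP | exact: IH].
by elim: nd => //= x l' xl _ ->; rewrite andbT; apply/negP => /InP.
Qed.

Lemma List_nthE (A : Type) (d : A) i l : List.nth i l d = nth d l i.
Proof. by elim: l i => [|x l IH] [|i] /=. Qed.

Lemma flat_map_allpairs (A B C : Type) (f : A -> B -> C) (s : seq A) (t : seq B) :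
  List.flat_map (fun a => List.map (f a) t) s = [seq f a b | a <- s, b <- t].
Proof.
by elim: s => //= a s ->.
Qed.

Lemma tuplesS k n : tuples k n.+1 = [seq a :: s | a <- iota 0 k, s <- tuples k n].
Proof. by rewrite /= flat_map_allpairs seqE. Qed.

Lemma mem_tuples k n s : (s \in tuples k n) = (size s == n) && all (fun a => a < k)%N s.
Proof.
elim: n s => [|n IH] s; first by case: s.
rewrite tuplesS; apply/allpairsP/idP => [[[a t] /= [ak tk ->]]|].
  by move: tk ak; rewrite IH mem_iota /= eqSS add0n => /andP[-> ->] ->.
case: s => //= a s; rewrite eqSS => /and3P[sn ak sk].
by exists (a, s); split; rewrite //= ?mem_iota ?IH ?sn.
Qed.

Lemma uniq_tuples k n : uniq (tuples k n).
Proof.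
elim: n => // n IH; rewrite tuplesS; apply: allpairs_uniq => //; first exact: iota_uniq.
by move=> [a s] [b t] _ _ /= [-> ->].
Qed.

Definition list_of n k (z : {ffun 'I_n -> 'I_k}) : list nat := [seq val (z i) | i <- enum 'I_n].

Lemma nth_list_of n k (z : {ffun 'I_n -> 'I_k}) (i : 'I_n) : nth 0%N (list_of z) i = z i.
Proof. by rewrite (nth_map i) ?size_enum_ord // nth_ord_enum. Qed.

Lemma list_of_inj n k : injective (@list_of n k).
Proof.
move=> z z' E; apply/ffunP => i; apply: val_inj.
have := congr1 (fun s => nth 0%N s i) E.
by rewrite !nth_list_of.
Qed.

Lemma list_of_onto n k s : s \in tuples k n -> exists z : {ffun 'I_n -> 'I_k}, s = list_of z.
Proof.
rewrite mem_tuples => /andP[/eqP sn /all_nthP sk].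
have sk' (i : 'I_n) : (nth 0 s i < k)%N by apply: sk; rewrite sn.
exists [ffun i => Ordinal (sk' i)]; apply: (@eq_from_nth _ 0%N).
  by rewrite size_map size_enum_ord.
move=> i; rewrite sn => i_n.
by rewrite (nth_map (Ordinal i_n)) ?size_enum_ord // ffunE /= nth_enum_ord.
Qed.

Lemma list_of_tuples n k (z : {ffun 'I_n -> 'I_k}) : list_of z \in tuples k n.
Proof.
rewrite mem_tuples size_map size_enum_ord eqxx /=.
by apply/allP => a /mapP[i _ ->]; exact: ltn_ord.
Qed.

Lemma lsum_tuples n k (F : list nat -> R) :
  lsum (tuples k n) F = \sum_(z : {ffun 'I_n -> 'I_k}) F (list_of z).
Proof.
rewrite lsumE -[RHS]big_enum /= -[RHS](big_map (@list_of n k) xpredT F).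
apply: perm_big; apply: uniq_perm; first exact: uniq_tuples.
  by rewrite map_inj_uniq ?enum_uniq //; exact: list_of_inj.
move=> s; apply/idP/mapP => [/list_of_onto[z ->]|[z _ ->]]; last exact: list_of_tuples.
by exists z; rewrite ?mem_enum.
Qed.

Lemma boolsS k : bools k.+1 = [seq b :: s | b <- [:: false; true], s <- bools k].
Proof. exact: (flat_map_allpairs (fun b s => b :: s) [:: false; true] (bools k)). Qed.

Lemma mem_bools k s : (s \in bools k) = (size s == k).
Proof.
elim: k s => [|k IH] s; first by case: s.
rewrite boolsS; apply/allpairsP/idP => [[[b t] /= [_ tk ->]]|].
  by rewrite IH in tk; rewrite /= eqSS.
case: s => //= b s; rewrite eqSS => sk.
by exists (b, s); split; rewrite //= ?IH //; case: b.
Qed.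

Lemma uniq_bools k : uniq (bools k).
Proof.
elim: k => // k IH; rewrite boolsS; apply: allpairs_uniq => //.
by move=> [a s] [b t] _ _ /= [-> ->].
Qed.

Definition bits_of k (w : {set 'I_k}) : list bool := [seq i \in w | i <- enum 'I_k].
Definition set_of_bits k (l : list bool) : {set 'I_k} := [set i : 'I_k | nth false l i].

Lemma nth_bits_of k (w : {set 'I_k}) (i : 'I_k) : nth false (bits_of w) i = (i \in w).
Proof. by rewrite (nth_map i) ?size_enum_ord // nth_ord_enum. Qed.

Lemma size_bits_of k (w : {set 'I_k}) : size (bits_of w) = k.
Proof. by rewrite size_map size_enum_ord. Qed.

Lemma bits_ofK k : cancel (@bits_of k) (@set_of_bits k).
Proof. by move=> w; apply/setP => i; rewrite inE nth_bits_of. Qed.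

Lemma set_ofK k l : size l = k -> bits_of (set_of_bits k l) = l.
Proof.
move=> lk; apply: (@eq_from_nth _ false); first by rewrite size_bits_of.
by move=> i; rewrite size_bits_of => ik; rewrite (nth_bits_of _ (Ordinal ik)) inE.
Qed.

Lemma lsum_bools k (F : list bool -> R) :
  lsum (bools k) F = \sum_(w : {set 'I_k}) F (bits_of w).
Proof.
rewrite lsumE -[RHS]big_enum /= -[RHS](big_map (@bits_of k) xpredT F).
apply: perm_big; apply: uniq_perm; first exact: uniq_bools.
  by rewrite map_inj_uniq ?enum_uniq //; exact: can_inj (@bits_ofK k).
move=> s; rewrite mem_bools; apply/eqP/mapP => [sk|[w _ ->]]; last exact: size_bits_of.
by exists (set_of_bits k s); rewrite ?mem_enum // set_ofK.
Qed.

Lemma lsum_filter (A : Type) (P : A -> bool) (l : seq A) (F : A -> R) :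
  lsum (List.filter P l) F = lsum l (fun a => if P a then F a else 0).
Proof.
rewrite !lsumE; elim: l => [|a l IH] /=; first by rewrite !big_nil.
by case: ifP => Pa; rewrite !big_cons Pa IH // add0r.
Qed.

Lemma combine_map (A B C : Type) (g : A -> B) (h : A -> C) s :
  List.combine (map g s) (map h s) = [seq (g i, h i) | i <- s].
Proof. by elim: s => //= i s ->. Qed.

Lemma List_mapE (A B : Type) (g : A -> B) s : List.map g s = map g s.
Proof. by []. Qed.

Lemma PnE (P : nat -> nat -> R) n k l (x : {ffun 'I_n -> 'I_k}) (y : {ffun 'I_n -> 'I_l}) :
  Pn P (list_of x) (list_of y) = \prod_i P (x i) (y i).
Proof.
rewrite /Pn combine_map List_mapE -map_comp -big_enum /=.
by elim: (enum 'I_n) => [|i s IH]; rewrite ?big_nil // big_cons -IH.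
Qed.

Lemma count_occE (l : seq nat) v : List.count_occ Nat.eq_dec l v = count_mem v l.
Proof.
elim: l => //= a l ->; case: Nat.eq_dec => [->|/eqP/negbTE ->] //.
by rewrite eqxx.
Qed.

Lemma ftypeE m f n k l (x : {ffun 'I_n -> 'I_k}) (y : {ffun 'I_n -> 'I_l}) :
  ftype m f n (list_of x) (list_of y) =
  [seq (type_count (fun (a : 'I_k) (b : 'I_l) => f a b) x y v)%:R / n%:R | v <- iota 0 m].
Proof.
rewrite /ftype seqE List_mapE; apply: eq_map => v.
rewrite !INRE RdivE; congr (_%:R / _).
rewrite combine_map List_mapE -map_comp count_occE count_map /type_count.
by rewrite -big_enum /= -sum1_count big_mkcond /=; apply: eq_bigr => i _; case: eqP.
Qed.

End ListTranslation.

(** * Simple loops and maximal edges *)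

Section LoopTranslation.

Lemma zip_iota (A B : Type) (x0 : A) (y0 : B) a b : size a = size b ->
  zip a b = [seq (nth x0 a i, nth y0 b i) | i <- iota 0 (size a)].
Proof.
move=> ab; apply: (@eq_from_nth _ (x0, y0)); first by rewrite size_zip size_map size_iota ab minnn.
move=> i; rewrite size_zip -ab minnn => ia.
by rewrite nth_zip // (nth_map 0%N) ?size_iota // nth_iota.
Qed.

Lemma nth_rot1 (A : Type) (y0 : A) b i : (i < size b)%N ->
  nth y0 (rot 1 b) i = nth y0 b (Nat.modulo (i + 1) (size b)).
Proof.
case: b => // y b; rewrite -[size (y :: b)]/(size b).+1 ltnS => ib.
rewrite rot1_cons addn1 nth_rcons.
have [ilt|] := ltnP i (size b); first by rewrite Nat.mod_small //; apply/ssrnat.ltP.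
move=> h; have -> : i = size b by apply/eqP; rewrite eqn_leq ib h.
by rewrite eqxx Nat.Div0.mod_same.
Qed.

Lemma lengthE (A : Type) (s : seq A) : List.length s = size s.
Proof. by []. Qed.

Lemma length_filterE (A : Type) (q : pred A) s : List.length (List.filter q s) = count q s.
Proof. by elim: s => //= x s <-; case: (q x). Qed.

Lemma count_zip_nth (h : nat -> nat -> nat) v a b : size b = size a ->
  List.length (List.filter (fun i => Nat.eqb (h (List.nth i a 0%N) (List.nth i b 0%N)) v)
    (List.seq 0 (size a))) = count (fun c => h c.1 c.2 == v) (zip a b).
Proof.
move=> ba; rewrite length_filterE seqE (@zip_iota _ _ 0%N 0%N) // count_map.
by apply: eq_count => i /=; rewrite !List_nthE; apply/Nat.eqb_spec/eqP.
Qed.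

Lemma count_zip_rot_nth (h : nat -> nat -> nat) v a b : size b = size a ->
  List.length (List.filter (fun i => Nat.eqb (h (List.nth i a 0%N)
     (List.nth (Nat.modulo (i + 1) (size a)) b 0%N)) v)
    (List.seq 0 (size a))) = count (fun c => h c.1 c.2 == v) (zip a (rot 1 b)).
Proof.
move=> ba; rewrite -count_zip_nth ?size_rot // !length_filterE seqE.
apply: eq_in_count => i; rewrite mem_iota add0n => /andP[_ ia].
by rewrite !List_nthE nth_rot1 ba.
Qed.

Lemma all_zipP (q : nat -> nat -> Prop) a b : size b = size a ->
  (forall i, (i < size a)%N -> q (nth 0%N a i) (nth 0%N b i)) <->
  (forall c, c \in zip a b -> q c.1 c.2).
Proof.
move=> ba; rewrite (@zip_iota _ _ 0%N 0%N) //; split=> [H c /mapP[i]|H i ia].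
  by rewrite mem_iota add0n => /andP[_ ia] -> /=; exact: H.
by apply: (H (_, _)); apply/mapP; exists i; rewrite ?mem_iota.
Qed.

Lemma zip_map (A B C D : Type) (g : A -> C) (h : B -> D) a b :
  zip (map g a) (map h b) = [seq (g c.1, h c.2) | c <- zip a b].
Proof. by elim: a b => [|x a IH] [|y b] //=; rewrite IH. Qed.

Lemma map_val_ord k (s : seq nat) : all (fun i => i < k)%N s ->
  exists t : seq 'I_k, s = map val t.
Proof.
elim: s => [|i s IH] /=; first by exists [::].
by case/andP => ik /IH[t ->]; exists (Ordinal ik :: t).
Qed.

Variables (nx ny m : nat) (P : nat -> nat -> R) (f : nat -> nat -> nat).
Hypothesis f_lt : forall x y, (x < nx)%N -> (y < ny)%N -> (f x y < m)%N.

Local Notation S := (fun (x : 'I_nx) (y : 'I_ny) => (0 < P x y)).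
Local Notation fo := (fun (x : 'I_nx) (y : 'I_ny) => f x y).

Lemma mem_bits_of (w : {set 'I_nx}) x :
  Defs.mem x (bits_of w) <-> exists2 i : 'I_nx, i \in w & x = i.
Proof.
rewrite /Defs.mem List_nthE; split=> [h|[i iw ->]]; last by rewrite nth_bits_of.
have [xn|xn] := ltnP x nx; last by move: h; rewrite nth_default // size_bits_of.
by exists (Ordinal xn) => //; rewrite -nth_bits_of.
Qed.

Lemma solvableP (w : {set 'I_nx}) : solvable ny m P f (bits_of w) <-> balanced S fo w.
Proof.
split=> [sol a b ab ua ub h1 h2 v|bal a b].
(* [loop_balanced] only tests [v < m]; by [f_lt] larger values are never taken and both counts are
   0. *)
- have [vm|vm] := ltnP v m; last first.
    have z0 (s : seq ('I_nx * 'I_ny)) : count (fun c : 'I_nx * 'I_ny => f c.1 c.2 == v) s = 0%N.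
      rewrite (@eq_count _ _ pred0) ?count_pred0 // => c /=.
      apply/eqP => E; have := f_lt (ltn_ord c.1) (ltn_ord c.2).
      by rewrite E ltnNge vm.
    by rewrite !z0.
  have := sol (map val a) (map val b).
  have sb : size (map val b) = size (map val a) by rewrite !size_map ab.
  rewrite /simple_loop /loop_balanced => H.
  have {H} := fun loop => H loop v (elimT ssrnat.ltP vm).
  rewrite !(lengthE (map val a)) count_zip_nth // count_zip_rot_nth // -map_rot !zip_map
    !count_map; apply.
  split; first exact: sb.
  split; first by apply/NoDupP; rewrite map_inj_uniq //; exact: val_inj.
  split; first by apply/NoDupP; rewrite map_inj_uniq //; exact: val_inj.
  have H1 : forall c, c \in zip (map val a) (map val b) ->
      Defs.mem c.1 (bits_of w) /\ (c.2 < ny)%coq_nat /\ inS P c.1 c.2.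
    rewrite zip_map => c /mapP[d /h1[dw Sd] ->] /=; split; first by apply/mem_bits_of; exists d.1.
    by split; [apply/ssrnat.ltP | apply/RltP].
  have H2 : forall c, c \in zip (map val a) (rot 1 (map val b)) -> inS P c.1 c.2.
    rewrite -map_rot zip_map => c /mapP[d /h2[dw Sd] ->] /=.
    by apply/RltP.
  move=> i /ssrnat.ltP ia; rewrite !List_nthE.
  have [mw [yn Sxy]] := (all_zipP (fun x y =>
    Defs.mem x (bits_of w) /\ (y < ny)%coq_nat /\ inS P x y) sb).2 H1 i ia.
  split=> //; split=> //.
  split=> //; have := (all_zipP (inS P) _).2 H2 i ia; rewrite nth_rot1 ?sb //; apply.
  by rewrite size_rot.
- rewrite /simple_loop /loop_balanced => -[sb [ua [ub H]]] v /ssrnat.ltP vm.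
  rewrite (lengthE a) in H *; have {}sb : size b = size a by exact: sb.
  rewrite count_zip_nth // count_zip_rot_nth //.
  have aw i : (i < size a)%N -> exists2 x : 'I_nx, x \in w & nth 0%N a i = x.
    by move=> ia; apply/mem_bits_of; rewrite -List_nthE; apply: (H i _).1; apply/ssrnat.ltP.
  have [|a' aE] := @map_val_ord nx a.
    by apply/(all_nthP 0%N) => i /aw[x _ ->]; exact: ltn_ord.
  have [|b' bE] := @map_val_ord ny b.
    apply/(all_nthP 0%N) => i; rewrite sb => ia; rewrite -List_nthE.
    by apply/ssrnat.ltP; apply: (H i _).2.1; apply/ssrnat.ltP.
  have a_in x : x \in a' -> x \in w.
    move=> xa; have [|y yw E] := aw (index x a').
      by rewrite aE size_map index_mem.
    by move: E; rewrite aE (nth_map x) ?index_mem // nth_index // => /val_inj ->.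
  have ab' : size a' = size b' by move: sb; rewrite aE bE !size_map.
  have H1 : forall c, c \in zip a b -> inS P c.1 c.2.
    apply/all_zipP => // i ia; rewrite -!List_nthE.
    by apply: (H i _).2.2.1; apply/ssrnat.ltP.
  have H2 : forall c, c \in zip a (rot 1 b) -> inS P c.1 c.2.
    apply/all_zipP; first by rewrite size_rot.
    move=> i ia; rewrite nth_rot1 ?sb // -!List_nthE.
    by apply: (H i _).2.2.2; apply/ssrnat.ltP.
  have fst_in (s : seq 'I_ny) c : size a' = size s -> c \in zip a' s -> c.1 \in a'.
    move=> E cz; rewrite -(@unzip1_zip _ _ a' s) ?E //; exact: map_f.
  have := bal a' b' ab' _ _ _ _ v; rewrite aE bE -map_rot !zip_map !count_map; apply.
  + by rewrite aE in ua; move/NoDupP in ua; rewrite map_inj_uniq in ua => //; exact: val_inj.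
  + by rewrite bE in ub; move/NoDupP in ub; rewrite map_inj_uniq in ub => //; exact: val_inj.
  + move=> c cz; split; first exact: a_in (fst_in _ _ ab' cz).
    by apply/RltP/(H1 (val c.1, val c.2)); rewrite aE bE zip_map; apply/mapP; exists c.
  + move=> c cz; split; first by apply: a_in (fst_in _ _ _ cz); rewrite size_rot.
    by apply/RltP/(H2 (val c.1, val c.2)); rewrite aE bE -map_rot zip_map; apply/mapP; exists c.
Qed.

Definition edge (w : {set 'I_nx}) : Prop := max_solvable nx ny m P f (bits_of w).

Lemma edge_balanced w : edge w -> balanced S fo w.
Proof. by case=> _ [/solvableP]. Qed.

(** A set that is not maximal has a strictly larger balanced superset; iterating shrinks the
    complement, so it stops. *)
Lemma edge_cover (A : {set 'I_nx}) : balanced S fo A ->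
  exists w, edge w /\ A \subset w.
Proof.
have [N] := ubnP #|~: A|; elim: N A => // N IH A; rewrite ltnS => AN bA.
have [eA|neA] := pselect (edge A); first by exists A.
have [B [bB AB]] : exists B, balanced S fo B /\ A \proper B.
  apply: contrapT => hn; apply: neA; split; first exact: size_bits_of.
  split; first exact/solvableP.
  move=> l lk sub soll x xl; apply: contrapT => xA; apply: hn.
  exists (set_of_bits nx l); have lE := set_ofK lk; split; first by apply/solvableP; rewrite lE.
  rewrite -lE in sub xl; apply/properP; split.
    apply/fintype.subsetP => i iA; have [|j jB E] := (mem_bits_of _ i).1 (sub i _).
      by apply/mem_bits_of; exists i.
    by rewrite (val_inj E).
  have [i iB xE] := (mem_bits_of _ x).1 xl; exists i => //.
  by apply/negP => iA; apply: xA; apply/mem_bits_of; exists i.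
have [|w [ew Bw]] := IH B _ bB.
  by apply: leq_trans AN; apply: proper_card; rewrite properE !finset.setCS -properE.
by exists w; split=> //; apply: fintype.subset_trans Bw; exact: proper_sub.
Qed.

(** Above a single letter the indicator is a function of [y]. Covers of singletons serve on the
    failed tests and show that feasible channels exist. *)
Lemma balanced_set1 (x : 'I_nx) : balanced S fo [set x].
Proof.
apply/(balancedP R) => v; exists (fun=> 0), (fun y : 'I_ny => ind (f x y == v)) => x' y.
by rewrite inE add0r => /eqP ->.
Qed.
End LoopTranslation.

(** * Channels indexed by bit lists *)

Section ChannelTranslation.
Variables (nx ny m : nat) (P : nat -> nat -> R) (f : nat -> nat -> nat).
Hypothesis P0 : forall x y, 0 <= P x y.

Local Notation p := (fun (x : 'I_nx) (y : 'I_ny) => P x y).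
Local Notation edge := (@edge nx ny m P f).
Local Notation ok := (fun (w : {set 'I_nx}) x => edge w /\ x \in w).

(** The total mass and the mass on edges containing [x] are both 1, so the nonnegative remainder
    vanishes term by term. *)
Lemma feasible_of_channel (Q : list bool -> nat -> R) : feasible_channel nx ny m P f Q ->
  feasible ok (fun w (x : 'I_nx) => Q (bits_of w) x).
Proof.
case=> Q0 [Qedge [Q1 Qin]].
have Q0' w x : 0 <= Q w x by apply/RleP; exact: Q0.
have Q1' (x : 'I_nx) : \sum_(w : {set 'I_nx}) Q (bits_of w) x = 1.
  by rewrite -(lsum_bools nx (fun l => Q l x)); apply: Q1; apply/ssrnat.ltP.
split=> // w x h.
have [ew|ne] := pselect (edge w); last exact: Qedge.
have xw : x \notin w by apply/negP => xw; apply: h.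
have := Qin x (elimT ssrnat.ltP (ltn_ord x)); rewrite lsum_filter lsum_bools.
under eq_bigr => v _ do rewrite List_nthE nth_bits_of.
rewrite -big_mkcond /= => E; have := Q1' x; rewrite (bigID (fun w : {set 'I_nx} => x \in w)) /= E.
move/eqP; rewrite -subr_eq0 addrAC subrr add0r psumr_eq0 => [/allP/(_ w)|*]; last exact: Q0'.
by rewrite mem_index_enum xw => /(_ isT)/eqP.
Qed.

Definition channel_of (Q : {set 'I_nx} -> 'I_nx -> R) (l : list bool) (x : nat) : R :=
  if insub x is Some i then (if size l == nx then Q (set_of_bits nx l) i else 0) else 0.

Lemma channel_ofE Q (w : {set 'I_nx}) (x : 'I_nx) : channel_of Q (bits_of w) x = Q w x.
Proof. by rewrite /channel_of valK size_bits_of eqxx bits_ofK. Qed.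

Lemma channel_of_feasible Q : feasible ok Q -> feasible_channel nx ny m P f (channel_of Q).
Proof.
case=> Q0 Q1 Qok; split.
  move=> l x; apply/RleP; rewrite /channel_of; case: insubP => // i _ _.
  by case: eqP => // _; exact: Q0.
split.
  move=> l x ne; rewrite /channel_of; case: insubP => // i _ _; case: eqP => // lk.
  by apply: Qok => -[e _]; apply: ne; rewrite -(set_ofK lk).
split=> x /ssrnat.ltP xn.
  rewrite lsum_bools; transitivity (\sum_w Q w (Ordinal xn)); last exact: Q1.
  apply: eq_bigr => w _; exact: (channel_ofE Q w (Ordinal xn)).
rewrite lsum_filter lsum_bools; transitivity (\sum_w Q w (Ordinal xn)); last exact: Q1.
apply: eq_bigr => w _.
rewrite List_nthE (nth_bits_of w (Ordinal xn)) (channel_ofE Q w (Ordinal xn)).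
by case: ifP => // xw; rewrite Qok // xw => -[].
Qed.

(** On positive terms [P x y] cancels from the ratio and leaves [P(w|x) / P(w|y)]; dividing by
    [ln 2] converts nats to bits. *)
Lemma cond_mutual_infoE (Q : list bool -> nat -> R) : (forall l x, 0 <= Q l x) ->
  cond_mutual_info nx ny P Q = cmi p (fun (w : {set 'I_nx}) (x : 'I_nx) => Q (bits_of w) x) / ln 2.
Proof.
move=> Q0; rewrite /cond_mutual_info lsum_bools /cmi mulr_suml.
apply: eq_bigr => w _; rewrite lsum_seq mulr_suml; apply: eq_bigr => x _.
rewrite lsum_seq mulr_suml; apply: eq_bigr => y _.
set Qw := fun (w : {set 'I_nx}) (x : 'I_nx) => Q (bits_of w) x.
have Qw0 v x' : 0 <= Qw v x' by exact: Q0.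
have p0 x' y' : 0 <= p x' y' by exact: P0.
case: Rlt_dec => [/RltP pq|npq]; last first.
  have -> : P x y * Q (bits_of w) x = 0; last by rewrite !mul0r.
  apply/eqP; rewrite eq_le mulr_ge0 // andbT leNgt; apply/negP => h.
  by apply: npq; apply/RltP.
have [px qx] : 0 < p x y /\ 0 < Qw w x by exact: mulr_gt0_inv.
have m0 : 0 < marg p y by apply: lt_le_trans px _; exact: marg_ge.
have J0 : 0 < joint p Qw w y by apply: (lt_le_trans (mulr_gt0 px qx)); exact: joint_ge.
rewrite !lsum_seq -/(marg p y) -/(joint p Qw w y) /log2 RmultE RdivE RlnE RlnE -mulrA.
congr (_ * (_ / ln _)).
rewrite -ln_div ?posrE ?divr_gt0 //; congr (ln _).
rewrite /recv -/(Qw w x) !RmultE RdivE.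
by field; rewrite ?(gt_eqF m0) ?(gt_eqF J0) ?(gt_eqF px).
Qed.
End ChannelTranslation.

(** * Coding theorem *)

Section CodingTheorem.
Variables (nx ny m : nat) (P : nat -> nat -> R) (f : nat -> nat -> nat).
Hypothesis P0 : forall x y, 0 <= P x y.
Hypothesis P1 : \sum_(x < nx) \sum_(y < ny) P x y = 1.
Hypothesis f_lt : forall x y, (x < nx)%N -> (y < ny)%N -> (f x y < m)%N.

Local Notation p := (fun (x : 'I_nx) (y : 'I_ny) => P x y).
Local Notation S := (fun (x : 'I_nx) (y : 'I_ny) => (0 < P x y)).
Local Notation fo := (fun (x : 'I_nx) (y : 'I_ny) => f x y).
Local Notation edge := (@edge nx ny m P f).
Local Notation ok := (fun (w : {set 'I_nx}) (x : 'I_nx) => edge w /\ x \in w).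
Local Notation fn n := (fun (x : {ffun 'I_n -> 'I_nx}) (y : {ffun 'I_n -> 'I_ny}) =>
  ftype m f n (list_of x) (list_of y)).

Let p0 (x : 'I_nx) (y : 'I_ny) : 0 <= p x y. Proof. exact: P0. Qed.

Lemma err_probE n (M : finType) enc dec (phi : {ffun 'I_n -> 'I_nx} -> M)
    (psi : M -> {ffun 'I_n -> 'I_ny} -> seq R) :
  (forall x y, dec n (enc n (list_of x)) (list_of y) = psi (phi x) y) ->
  err_prob nx ny m P f enc dec n = error_mass p phi psi (fn n).
Proof.
move=> H; rewrite /err_prob lsum_tuples; apply: eq_bigr => x _.
rewrite lsum_tuples; apply: eq_bigr => y _.
rewrite PnE RmultE H; congr (_ * _).
by case: list_R_eq_dec => [->|/eqP/negPf ->]; rewrite ?eqxx.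
Qed.

Lemma cover_exists : exists cover : {set 'I_nx} -> {set 'I_nx},
  forall A, balanced S fo A -> edge (cover A) /\ A \subset cover A.
Proof.
suff /choice[cover H] : forall A : {set 'I_nx}, exists w, balanced S fo A -> edge w /\ A \subset w.
  by exists cover.
move=> A; have [bA|nb] := pselect (balanced S fo A); last by exists A.
by have [w] := edge_cover f_lt bA; exists w.
Qed.

Lemma feasible_exists : exists Q : {set 'I_nx} -> 'I_nx -> R, feasible ok Q.
Proof.
have [cover cP] := cover_exists.
exists (fun w x => ind (cover [set x]%SET == w)); split=> // [x|w x].
  by rewrite (bigD1 (cover [set x]%SET)) //= eqxx big1 ?addr0 // => w; rewrite eq_sym => /negbTE ->.
case: eqP => // <- []; have [e /fintype.subsetP s] := cP _ (@balanced_set1 nx ny P f x).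
by split=> //; apply: s; rewrite inE.
Qed.

Lemma converse_rate (h r : R) : (forall Q, feasible ok Q -> h <= cmi p Q) ->
  achievable nx ny m P f r -> h <= r * ln 2.
Proof.
move=> hmin [M [enc [dec [encM [err0 rate]]]]].
have [cover cP] := cover_exists.
have ln2 : 0 < ln 2 :> R by rewrite ln_gt0 // ltr1n.
apply/ler_addgt0Pr => e e0; have e3 : 0 < e / 3 by rewrite divr_gt0.
(* The slack [e] is shared equally by the mixture, [- ln (1 - d) = e / 3], the decoding errors and
   the excess rate. *)
pose d := 1 - expR (- (e / 3)).
have d01 : 0 < d < 1.
  by rewrite /d subr_gt0 expR_lt1 oppr_lt0 e3 /= ltrBlDr ltrDl expR_gt0.
have lnd : ln (1 - d) = - (e / 3) by rewrite /d opprB addrC subrK expRK.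
pose C := penalty p d * invmass p.
have C0 : 0 <= C.
  by rewrite mulr_ge0 ?penalty_ge0 // (le_trans ler01) // invmass_ge1.
(* [C + 1] because [C] may be 0. *)
have e4 : Rlt 0 (e / 3 / (C + 1)) by apply/RltP; rewrite divr_gt0 // ltr_wpDl.
have e5 : Rlt 0 (e / 3 / ln 2) by apply/RltP; rewrite divr_gt0.
have [N1 HN1] := err0 _ e4; have [N2 HN2] := rate _ e5.
pose n := (N1 + N2).+1.
have n0 : 0 < (n%:R : R) by rewrite ltr0n.
have {}HN1 : `|err_prob nx ny m P f enc dec n| < e / 3 / (C + 1).
  rewrite -[err_prob _ _ _ _ _ _ _ _]subr0 -RdistE; apply/RltP; apply: HN1.
  by apply/ssrnat.leP; rewrite (leq_trans (leq_addr N2 N1)).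
have {}HN2 : ln (M n)%:R <= (r + e / 3 / ln 2) * ln 2 * n%:R.
  have /RleP : Rle (log2 (INR (M n)) / INR n) (r + e / 3 / ln 2).
    by apply: HN2; apply/ssrnat.leP; rewrite (leq_trans (leq_addl N1 N2)).
  by rewrite /log2 !INRE !RdivE !RlnE ler_pdivrMr // ler_pdivrMr // mulrAC.
have encP (x : {ffun 'I_n -> 'I_nx}) : (enc n (list_of x) < M n)%N.
  by apply/ssrnat.ltP; apply: encM; apply/InP; exact: list_of_tuples.
pose phi x := Ordinal (encP x).
pose psi (c : 'I_(M n)) (y : {ffun 'I_n -> 'I_ny}) : seq R := dec n c (list_of y).
have Eerr : err_prob nx ny m P f enc dec n = error_mass p phi psi (fn n) by exact: err_probE.
have fn_count (x : {ffun 'I_n -> 'I_nx}) (y : {ffun 'I_n -> 'I_ny}) v : (v < m)%N ->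
    nth 0 (fn n x y) v * n%:R = (type_count fo x y v)%:R.
  by move=> vm; rewrite ftypeE (nth_map 0%N) ?size_iota // nth_iota // divfK // gt_eqF.
have hmin' (Q : {set 'I_nx} -> 'I_nx -> R) : (forall w x, 0 <= Q w x) ->
    (forall x, \sum_w Q w x = 1) -> (forall w x, ~ edge w -> Q w x = 0) ->
    (forall (w : {set 'I_nx}) x, x \notin w -> Q w x = 0) -> h <= cmi p Q.
  move=> Q0 Q1 Q2 Q3; apply: hmin; split=> // w x hok.
  have [ew|] := pselect (edge w); last exact: Q2.
  by apply: Q3; apply/negP => xw; apply: hok.
have conf i c y : balanced S fo (confusable p phi psi (fn n) i c y).
  apply: (@confusable_balanced R 'I_n 'I_nx 'I_ny fo 'I_(M n) (seq R) p phi psi (fn n)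
    (fun v => (v < m)%N) (fun v z => nth 0 z v * n%:R) fn_count).
  by move=> a b; exact: f_lt.
have In0 : (0 < #|'I_n|)%N by rewrite card_ord.
have := converse p0 P1 hmin' cP (@balanced_set1 nx ny P f) conf d01 In0.
rewrite !card_ord -Eerr; set E := err_prob _ _ _ _ _ _ _ _ in HN1 *.
rewrite mulrA -/C lnd => key.
  have CE : C * E <= e / 3.
    apply: (@le_trans _ _ ((C + 1) * `|E|)).
      apply: (@le_trans _ _ (C * `|E|)); first by apply: ler_wpM2l => //; exact: ler_norm.
    by apply: ler_wpM2r => //; rewrite lerDl.
    by rewrite mulrC -ler_pdivlMr ?ltW // ltr_wpDl.
  have : n%:R * (h + - (e / 3) - C * E) <= n%:R * (r * ln 2 + e / 3).
    apply: le_trans key (le_trans HN2 _).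
    by rewrite mulrC mulrDl divfK // gt_eqF.
  by rewrite ler_pM2l //; lra.
Qed.

Lemma list_of_can n k (i0 : 'I_k) : exists g, cancel (@list_of n k) g.
Proof.
exists (fun s => if [pick z | list_of z == s] is Some z then z else [ffun=> i0]) => z.
by case: pickP => [z' /eqP/list_of_inj //|/(_ z)]; rewrite eqxx.
Qed.

(** [D] stands for the number of cells of the joint type, whose transmission costs at most
    [D ln (n + 1)]. Length 0 carries no bound, since the estimates divide by [n]. *)
Definition good_code (Q : {set 'I_nx} -> 'I_nx -> R) eps (D n : nat)
    (c : nat * (seq nat -> nat) * (nat -> seq nat -> seq R)) : Prop :=
  (forall xs, List.In xs (tuples nx n) -> (c.1.2 xs < c.1.1)%coq_nat) /\
  ((0 < n)%N ->
   `|err_prob nx ny m P f (fun=> c.1.2) (fun=> c.2) n| <= coding_constant p Q eps / n%:R /\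
   ln c.1.1%:R <= ln 2 + n%:R * (cmi p Q + 4 * eps) + D%:R * ln n.+1%:R).

Lemma good_code_exists Q eps : feasible ok Q -> 0 < eps ->
  exists D, forall n, exists c, good_code Q eps D n c.
Proof.
move=> [Q0 Q1 Qok] eps0.
have [x0 [y0 _]] := pmf_pos_ex p0 P1.
exists (#|{set 'I_nx}| * nx)%N => n.
have [n0|n0] := posnP n.
  exists (1%N, (fun=> 0%N), (fun _ _ => [::])); split; last by rewrite n0.
  by move=> xs _ /=; apply/ssrnat.ltP.
have okQ n' (w : {ffun 'I_n' -> {set 'I_nx}}) (x : {ffun 'I_n' -> 'I_nx}) :
    (forall i, 0 < Q (w i) (x i)) -> forall i, edge (w i) /\ x i \in w i.
  move=> Qp i; apply: contrapT => /Qok E; by have := Qp i; rewrite E ltxx.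
have fn_type (w : {ffun 'I_n -> {set 'I_nx}}) (x x' : {ffun 'I_n -> 'I_nx}) (y : {ffun 'I_n ->
  'I_ny}) :
    (forall i, 0 < Q (w i) (x i)) -> (forall i, 0 < Q (w i) (x' i)) ->
    (forall i, 0 < p (x i) (y i)) -> (forall i, 0 < p (x' i) (y i)) ->
    joint_type w x = joint_type w x' -> fn n x y = fn n x' y.
  move=> /okQ wx /okQ wx' px px' jt; rewrite !ftypeE; apply: eq_map => v.
  congr (_%:R / _).
  apply: (@type_count_joint_type R _ _ _ S fo w) => // i; try by case: (wx i); case: (wx' i).
  by apply: (@edge_balanced nx ny m P f f_lt); case: (wx i).
have [|L [phi [psi [E1 E2]]]] :=
  @iid_coding R _ _ _ p Q p0 P1 Q0 Q1 'I_n (seq R) (fn n) [::] (finset.set0 : {set 'I_nx}) eps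
    eps0 _ fn_type.
  by rewrite card_ord.
have nE : #|'I_n|%:R = n%:R :> R by rewrite card_ord.
rewrite nE in E1 E2.
pose Msg := ('I_L.+1 * {ffun {set 'I_nx} * 'I_nx -> 'I_#|'I_n|.+1})%type.
have [gx gxK] := @list_of_can n nx x0; have [gy gyK] := @list_of_can n ny y0.
pose e xs : nat := enum_rank (phi (gx xs) : Msg).
pose dcd c ys : seq R := if insub c is Some j then psi (enum_val (j : 'I_#|{: Msg}|)) (gy ys)
  else [::].
exists (#|{: Msg}|, e, dcd); split=> [xs _|_]; first by apply/ssrnat.ltP; exact: ltn_ord.
split.
  rewrite (@err_probE n _ (fun=> e) (fun=> dcd) phi psi) => [|x y]; last first.
    by rewrite /e /dcd gxK valK enum_rankK gyK.
  by rewrite ger0_norm //; apply: sumr_ge0 => x _; apply: sumr_ge0 => y _;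
    rewrite mulr_ge0 // prodr_ge0.
rewrite /= card_prod card_ffun !card_prod !card_ord natrM natrX.
by rewrite lnM ?posrE ?exprn_gt0 ?ltr0n // lnXn ?ltr0n // -[ln n.+1%:R *+ _]mulr_natl lerD2r.
Qed.

Lemma achievable_rate Q (r : R) : feasible ok Q -> cmi p Q < r * ln 2 ->
  achievable nx ny m P f r.
Proof.
move=> fQ rQ.
have ln2 : 0 < ln 2 :> R by rewrite ln_gt0 // ltr1n.
(* Of the six shares, four are spent by the code, one on the joint type and one on the additive
   constant [c0]. *)
pose eps := (r * ln 2 - cmi p Q) / 6.
have eps0 : 0 < eps by rewrite divr_gt0 // subr_gt0.
have [D /choice[c cP]] := good_code_exists fQ eps0.
exists (fun n => (c n).1.1), (fun n => (c n).1.2), (fun n => (c n).2); split.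
  by move=> n xs; case: (cP n) => + _; apply.
pose Cc := coding_constant p Q eps.
have Cc0 : 0 <= Cc.
  case: fQ => Q0 _ _; rewrite /Cc /coding_constant.
  apply: addr_ge0; last by rewrite divr_ge0 ?(ltW eps0).
  by apply: addr_ge0; rewrite divr_ge0 ?sqr_ge0 // sumr_ge0 // => z _;
    rewrite mulr_ge0 ?sqr_ge0 // mulr_ge0.
split.
  move=> e /RltP e0; exists (Num.truncn (Cc / e)).+1 => n /ssrnat.leP Nn.
  have n0 : (0 < n)%N by exact: leq_trans Nn.
  have nR : 0 < (n%:R : R) by rewrite ltr0n.
  apply/RltP; rewrite RdistE subr0; have [_ /(_ n0)[E _]] := cP n.
  apply: (le_lt_trans E); rewrite -/Cc ltr_pdivrMr // mulrC -ltr_pdivrMr //.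
  have /andP[_ h] := Num.Theory.truncn_itv (divr_ge0 Cc0 (ltW e0)).
  by apply: lt_le_trans h _; rewrite ler_nat.
move=> e /RltP e0.
(* Chosen so that [D t <= eps] and [t <= 1]; the latter gives [t (n + 1) <= 1 + t n <= expR (t n)],
   hence a linear bound on [ln (n + 1)] of slope [t]. *)
pose t := eps / (D%:R + 1 + eps).
have D1 : 0 < D%:R + 1 + eps by rewrite addr_gt0 // ltr_wpDl.
have t0 : 0 < t by rewrite divr_gt0.
have t1 : t <= 1 by rewrite ler_pdivrMr // mul1r lerDr addr_ge0.
have Dt : D%:R * t <= eps.
  rewrite mulrA ler_pdivrMr // [D%:R * _]mulrC ler_pM2l //; have : 0 <= (D%:R : R) by []; lra.
pose c0 := ln 2 - D%:R * ln t.
exists (Num.truncn (`|c0| / eps)).+1 => n /ssrnat.leP Nn.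
have n0 : (0 < n)%N by exact: leq_trans Nn.
have nR : 0 < (n%:R : R) by rewrite ltr0n.
have [_ /(_ n0)[_ E]] := cP n.
have lnn : ln (n.+1%:R : R) <= t * n%:R - ln t.
  have : ln (t * n.+1%:R) <= t * n%:R.
    rewrite -[leRHS]expRK ler_ln ?posrE ?expR_gt0 //; last by rewrite pmulr_rgt0 // ltr0n.
    apply: le_trans (expR_ge1Dx _); rewrite -natr1 mulrDr mulr1; lra.
  by rewrite lnM ?posrE ?ltr0n //; lra.
have c0n : c0 <= eps * n%:R.
  rewrite -ler_pdivrMl // mulrC; apply: (@le_trans _ _ (`|c0| / eps)).
    by rewrite ler_pM2r ?invr_gt0 // ler_norm.
  have /andP[_ h] := Num.Theory.truncn_itv (divr_ge0 (normr_ge0 c0) (ltW eps0)).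
  by apply: ltW; apply: lt_le_trans h _; rewrite ler_nat.
apply/RleP; rewrite /log2 !INRE !RdivE !RlnE ler_pdivrMr // ler_pdivrMr //.
apply: (@le_trans _ _ (n%:R * (r * ln 2))); last first.
  by rewrite mulrC mulrAC ler_pM2r // ler_pM2r // RplusE lerDl ltW.
apply: (le_trans E).
have h1 : D%:R * ln n.+1%:R <= D%:R * (t * n%:R - ln t) by apply: ler_wpM2l.
have h2 : D%:R * t * n%:R <= eps * n%:R by apply: ler_wpM2r.
have -> : r * ln 2 = cmi p Q + 6 * eps by rewrite /eps; field.
rewrite /c0 in c0n.
by lra.
Qed.

Lemma coding_theorem_ord : exists h, is_cond_hyp_entropy nx ny m P f h /\
  is_inf (achievable nx ny m P f) h.
Proof.
have ln2 : 0 < ln 2 :> R by rewrite ln_gt0 // ltr1n.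
have [Q [fQ Qmin]] := cmi_min_exists p0 feasible_exists.
exists (cmi p Q / ln 2); split; split.
- exists (channel_of Q); have fc := channel_of_feasible fQ; split=> //.
  rewrite cond_mutual_infoE //; last by move=> l x; apply/RleP; case: fc.
  by congr (cmi _ _ / _); apply/funext => w; apply/funext => x; exact: channel_ofE.
- move=> Q' fQ'; apply/RleP; rewrite cond_mutual_infoE //; last by move=> l x; apply/RleP;
  case: fQ'.
  by rewrite ler_pM2r ?invr_gt0 //; apply: Qmin; exact: feasible_of_channel.
- by move=> r /(converse_rate Qmin) h; apply/RleP; rewrite ler_pdivrMr.
- move=> b bmin; apply/RleP; rewrite leNgt; apply/negP => hb.
  pose r := (cmi p Q / ln 2 + b) / 2.
  have r1 : cmi p Q / ln 2 < r by rewrite /r; lra.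
  have : (b <= r) by apply/RleP; apply: bmin; apply: achievable_rate fQ _; rewrite -ltr_pdivrMr.
  by rewrite /r; lra.
Qed.
End CodingTheorem.

Lemma coding_theorem (nx ny m : nat) (P : nat -> nat -> R) (f : nat -> nat -> nat) :
  (forall x y, Rle 0 (P x y)) ->
  lsum (List.seq 0 nx) (fun x => lsum (List.seq 0 ny) (fun y => P x y)) = 1 ->
  (forall x y, (x < nx)%coq_nat -> (y < ny)%coq_nat -> (f x y < m)%coq_nat) ->
  exists h, is_cond_hyp_entropy nx ny m P f h /\ is_inf (achievable nx ny m P f) h.
Proof.
move=> P0 P1 f_lt; apply: coding_theorem_ord.
- by move=> x y; apply/RleP.
- by rewrite -P1 lsum_seq; apply: eq_bigr => x _; rewrite lsum_seq.
- by move=> x y /ssrnat.ltP xn /ssrnat.ltP yn; apply/ssrnat.ltP; exact: f_lt.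
Qed.

End TypeFunctionCoding.

Theorem theorem2 (nx ny m : nat) (P : nat -> nat -> R) (f : nat -> nat -> nat)
  (HPnn : forall x y, 0 <= P x y)
  (HPout : forall x y, (nx <= x)%nat \/ (ny <= y)%nat -> P x y = 0)
  (HPsum : lsum (seq 0 nx) (fun x => lsum (seq 0 ny) (fun y => P x y)) = 1)
  (HPX : forall x, (x < nx)%nat -> 0 < lsum (seq 0 ny) (fun y => P x y))
  (Hf : forall x y, (x < nx)%nat -> (y < ny)%nat -> (f x y < m)%nat) :
  exists h, is_cond_hyp_entropy nx ny m P f h /\
            is_inf (achievable nx ny m P f) h.
Proof.
exact (TypeFunctionCoding.coding_theorem HPnn HPsum Hf).
Qed.
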